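(* For speed functions $c$ (satisfying Assumptions A and B of the context) the following phenomena can occur. (1) $\Gamma_c(x,y)$ is not necessarily concave, and its level curves are not necessarily convex; this occurs for some speed function $c_\ell$ of the shifted two-phase model. (2) $\Gamma_c(x,y)$ may exhibit flat edges (a level curve of $\Gamma_c$ may contain a non-degenerate straight line segment); this occurs for some $c_\ell$. (3) $\Gamma_c(x,y)$ is not necessarily differentiable on the interior of $\mathbb{R}^2_+$; this occurs for some $c_\ell$. (4) For some $c$ and some $(x,y)$, the maximisers of the variational formula defining $\Gamma_c(x,y)$ are not unique (as curves, i.e. up to reparametrisation). (5) For some $c$ there exist terminal points $(x,y)$ for which the maximiser of the variational formula defining $\Gamma_c(x,y)$ has an initial segment on one of the coordinate axes.
   Context: $\mathbb{R}_+=[0,\infty)$, $\gamma(x,y)=(\sqrt x+\sqrt y)^2$. $\mathcal H(x,y)$ is the set of continuous, piecewise $C^1$ paths $\mathbf x=(x_1,x_2):[0,1]\to\mathbb{R}^2_+$ with $\mathbf x(0)=(0,0)$, $\mathbf x(1)=(x,y)$ and $\mathbf x'(s)\in\mathbb{R}^2_+$ wherever defined, and the variational formula is $$\Gamma_c(x,y)=\sup_{\mathbf x\in\mathcal H(x,y)}\int_0^1\frac{\gamma(\mathbf x'(s))}{c(x_1(s),x_2(s))}\,ds.$$ Shifted two-phase model: for $\lambda\in\mathbb{R}_+$, $r\in(0,1)$, $c_\ell(x,y)=1$ if $y>x-\lambda$ and $c_\ell(x,y)=r$ if $y\le x-\lambda$. Assumption A (discontinuity curves). $c$ is discontinuous on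 a (possibly) countable, locally finite family of curves $\{h_i\}$ such that: each $h_i$ is either a linear segment or strictly monotone; if not a vertical segment, it is the graph of a function $h_i:[z_i,w_i]\to\mathbb{R}$; if strictly increasing, $h_i\in C^1((z_i,w_i),\mathbb{R})$ (at the endpoints the derivative may be $0$ or $\pm\infty$) and $h_i'(s)=0$ has finitely many solutions in $[z_i,w_i]$; if strictly decreasing, $h_i$ is continuous. The curves separate $\mathbb{R}^2_+$ into open regions, finitely many in any compact set; an interior point of $h_i$ is a non-endpoint lying on no other curve, and near an interior point $\mathbf w$ the curve $h_i$ splits a small ball $B(\mathbf w,\varepsilon)$ into the parts $U_{\varepsilon,\mathbf w}$, $L_{\varepsilon,\mathbf w}$ above and below (the two sides of) $h_i$, and $h_i\cap B(\mathbf w,\varepsilon)$. All other points of the curves are finitely many in any compact set. Assumption B. (1) $c$ is continuous on each open region and lower semicontinuous on $\mathbb{R}^2_+$, and for every $i$ and interior point $\mathbf w\in h_i$ there exist $\varepsilon>0$ and $Q_{i,\mathbf w}\in\{L_{\varepsilon,\mathbf w},U_{\varepsilon,\mathbf w}\}$ such that for every $\mathbf y\in B(\mathbf w,\varepsilon)\cap h_i$ and every sequence $\mathbf z_n\in Q_{i,\mathbf w}\cap B(\mathbf w,\varepsilon)$ with $\mathbf z_n\to\mathbf y$, $c(\mathbf z_n)\to c(\mathbf y)$. (2) On every compact set, $c$ is bounded above and bounded below by a positive constant. *)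

(* Defs.v *)
From HB Require Import structures.
From mathcomp Require Import all_boot all_order all_algebra.
From mathcomp Require Import all_classical all_reals all_analysis.

Set Implicit Arguments.
Unset Strict Implicit.
Unset Printing Implicit Defensive.

Import Order.TTheory GRing.Theory Num.Theory.
Import numFieldNormedType.Exports.

Local Open Scope classical_set_scope.
Local Open Scope ring_scope.

(* The factors are R^o so that the product is a normed module over R; its norm
   is the maximum norm, so [ball u e] is an open square of side 2e. Every use
   of balls below is insensitive to this choice of norm. *)
Definition plane (R : realType) : normedModType R := (R^o * R^o)%type.

Definition quadrant (R : realType) : set (plane R) :=
  [set u | 0 <= u.1 /\ 0 <= u.2].

Definition lpp_gamma (R : realType) (u : plane R) : R :=
  (Num.sqrt u.1 + Num.sqrt u.2) ^+ 2.

(* The function g is the derivative on the open piece together with its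
   one-sided limits at the two ends. *)
Definition piecewise_C1 (R : realType) (f : R -> R) : Prop :=
  exists (n : nat) (t : nat -> R),
    [/\ t 0%N = 0, t n = 1, (forall k, (k < n)%N -> t k < t k.+1)
      & forall k, (k < n)%N -> exists g : R -> R,
          {within `[t k, t k.+1], continuous g} /\
          (forall s, s \in `]t k, t k.+1[ -> is_derive s (1 : R) f (g s))].

Definition velocity (R : realType) (p : R -> plane R) (s : R) : plane R :=
  (derive1 (fun s => (p s).1 : R^o) s, derive1 (fun s => (p s).2 : R^o) s).

(* Paths are total functions on R of which only the restriction to [0, 1]
   matters. *)
Record lpp_path (R : realType) (x y : R) (p : R -> plane R) : Prop := LppPath {
  path_cont : {within `[0, 1], continuous p};
  path_C1_fst : piecewise_C1 (fun s => (p s).1);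
  path_C1_snd : piecewise_C1 (fun s => (p s).2);
  path_quadrant : forall s, s \in `[0, 1] -> quadrant (p s);
  path_start : p 0 = (0, 0);
  path_end : p 1 = (x, y);
  path_monotone : forall s, s \in `]0, 1[ ->
    derivable (fun s => (p s).1 : R^o) s 1 ->
    derivable (fun s => (p s).2 : R^o) s 1 ->
    quadrant (velocity p s) }.

(* The velocity has junk values at the finitely many points where it does
   not exist, which the Lebesgue integral ignores. The Lebesgue integral is
   needed: a C^1 path may meet a discontinuity curve in a set of positive
   measure with empty interior. *)
Definition path_time (R : realType) (c : plane R -> R) (p : R -> plane R) :
    \bar R :=
  (\int[@lebesgue_measure R]_(s in `[0%R, 1%R])
     (lpp_gamma (velocity p s) / c (p s))%:E)%E.

(* The supremum is finite on the quadrant as soon as c is bounded below by a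
   positive constant on compact sets, so that [fine] loses nothing there. *)
Definition Gamma (R : realType) (c : plane R -> R) (u : plane R) : R :=
  fine (ereal_sup [set path_time c p | p in lpp_path u.1 u.2]).

Definition maximiser (R : realType) (c : plane R -> R) (x y : R)
    (p : R -> plane R) : Prop :=
  lpp_path x y p /\
  forall q, lpp_path x y q -> (path_time c q <= path_time c p)%E.

Definition reparam (R : realType) (phi : R -> R) : Prop :=
  [/\ {within `[0, 1], continuous phi}, phi 0 = 0, phi 1 = 1
    & forall s t, s \in `[0, 1] -> t \in `[0, 1] -> s <= t -> phi s <= phi t].

(* Two reparametrisations, because either path may pause. *)
Definition same_curve (R : realType) (p q : R -> plane R) : Prop :=
  exists phi psi : R -> R, [/\ reparam phi, reparam psi
    & forall s, s \in `[0, 1] -> p (phi s) = q (psi s)].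

Definition initial_axis_segment (R : realType) (p : R -> plane R) : Prop :=
  exists s : R, [/\ s \in `[0, 1], p s <> (0, 0)
    & (forall t, t \in `[0, s] -> (p t).2 = 0) \/
      (forall t, t \in `[0, s] -> (p t).1 = 0)].

Inductive dcurve (R : realType) :=
| VSeg of R & R & R          (* VSeg a y0 y1 : from (a, y0) up to (a, y1) *)
| Graph of R & R & (R -> R). (* Graph z w f : graph of f on [z, w] *)

Definition trace (R : realType) (h : dcurve R) : set (plane R) :=
  match h with
  | VSeg a y0 y1 => [set u | u.1 = a /\ y0 <= u.2 <= y1]
  | Graph z w f => [set u | z <= u.1 <= w /\ u.2 = f u.1]
  end.

Definition endpoint (R : realType) (h : dcurve R) : set (plane R) :=
  match h with
  | VSeg a y0 y1 => [set (a, y0); (a, y1)]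
  | Graph z w f => [set (z, f z); (w, f w)]
  end.

(* The side above the curve; left of it for a vertical segment. *)
Definition upper (R : realType) (h : dcurve R) : set (plane R) :=
  match h with
  | VSeg a y0 y1 => [set u | u.1 < a /\ y0 < u.2 < y1]
  | Graph z w f => [set u | z < u.1 < w /\ f u.1 < u.2]
  end.

Definition lower (R : realType) (h : dcurve R) : set (plane R) :=
  match h with
  | VSeg a y0 y1 => [set u | a < u.1 /\ y0 < u.2 < y1]
  | Graph z w f => [set u | z < u.1 < w /\ u.2 < f u.1]
  end.

Definition linear_on (R : realType) (z w : R) (f : R -> R) : Prop :=
  exists m b : R, forall s, s \in `[z, w] -> f s = m * s + b.

Definition increasing_C1_on (R : realType) (z w : R) (f : R -> R) : Prop :=
  [/\ (forall s t, s \in `[z, w] -> t \in `[z, w] -> s < t -> f s < f t),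
      (forall s, s \in `]z, w[ -> derivable (f : R -> R^o) s 1),
      {within `]z, w[, continuous (derive1 (f : R -> R^o))}
    & finite_set [set s | (s \in `]z, w[) /\ derive1 (f : R -> R^o) s = 0]].

Definition decreasing_on (R : realType) (z w : R) (f : R -> R) : Prop :=
  forall s t, s \in `[z, w] -> t \in `[z, w] -> s < t -> f t < f s.

Definition wf_dcurve (R : realType) (h : dcurve R) : Prop :=
  trace h `<=` quadrant (R := R) /\
  match h with
  | VSeg a y0 y1 => y0 < y1
  | Graph z w f => [/\ z < w, {within `[z, w], continuous f}
      & [\/ linear_on z w f, increasing_C1_on z w f | decreasing_on z w f]]
  end.

(* A family of curves is given by I : set nat and h : nat -> dcurve R. *)
Definition interior_pt (R : realType) (I : set nat) (h : nat -> dcurve R)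
    (i : nat) (w : plane R) : Prop :=
  [/\ trace (h i) w, ~ endpoint (h i) w
    & forall j, I j -> j <> i -> ~ trace (h j) w].

(* Both sides lie in the domain of c, which rules out a curve running along a
   coordinate axis. *)
Definition splits_ball (R : realType) (h : dcurve R) (w : plane R) (e : R) :
    Prop :=
  [/\ 0 < e, ball w e `<=` quadrant (R := R)
    & ball w e `<=` upper h `|` lower h `|` trace h].

Definition regions (R : realType) (I : set nat) (h : nat -> dcurve R) :
    set (set (plane R)) :=
  let D := quadrant (R := R) `\` \bigcup_(i in I) trace (h i) in
  [set connected_component D u | u in D].

Record assumption_A (R : realType) (c : plane R -> R) (I : set nat)
    (h : nat -> dcurve R) : Prop := AssumptionA {
  A_curves : forall i, I i -> wf_dcurve (h i);
  A_discont : forall i w, I i -> trace (h i) w ->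
    ~ (c u @[u --> within (quadrant (R := R)) (nbhs w)] --> c w);
  A_locally_finite : forall u, quadrant u -> exists2 V, nbhs u V &
    finite_set [set i | I i /\ trace (h i) `&` V !=set0];
  A_regions : forall K, compact K -> K `<=` quadrant (R := R) ->
    finite_set [set U | regions I h U /\ U `&` K !=set0];
  A_splits : forall i w, I i -> interior_pt I h i w ->
    exists e, splits_ball (h i) w e;
  A_exceptional : forall K, compact K -> K `<=` quadrant (R := R) ->
    finite_set [set w | K w /\
      exists i, [/\ I i, trace (h i) w & ~ interior_pt I h i w]] }.

Record assumption_B (R : realType) (c : plane R -> R) (I : set nat)
    (h : nat -> dcurve R) : Prop := AssumptionB {
  B_cont : forall U, regions I h U -> {within U, continuous c};
  B_lsc : lower_semicontinuous
    ((fun u => (c u)%:E) : subspace (quadrant (R := R)) -> \bar R);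
  B_one_sided : forall i w, I i -> interior_pt I h i w ->
    exists (e : R) (Q : set (plane R)),
      [/\ splits_ball (h i) w e,
          Q = lower (h i) `&` ball w e \/ Q = upper (h i) `&` ball w e
        & forall y, ball w e y -> trace (h i) y ->
          forall z : nat -> plane R, (forall n, Q (z n)) ->
          z n @[n --> \oo] --> y -> c (z n) @[n --> \oo] --> c y];
  B_bounded : forall K, compact K -> K `<=` quadrant (R := R) ->
    exists m M : R, 0 < m /\ forall u, K u -> m <= c u <= M }.

Definition speed_function (R : realType) (c : plane R -> R) : Prop :=
  exists (I : set nat) (h : nat -> dcurve R),
    assumption_A c I h /\ assumption_B c I h.

Definition shifted_two_phase (R : realType) (lambda r : R) (u : plane R) : R :=
  if u.1 - lambda < u.2 then 1 else r.

Definition concave_on (R : realType) (D : set (plane R)) (f : plane R -> R) :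
    Prop :=
  convex_function (D : set (convex_lmodType (plane R))) (fun u => - f u).

Definition level_curve (R : realType) (c : plane R -> R) (t : R) :
    set (plane R) :=
  [set u | quadrant u /\ Gamma c u = t].

(* A plane curve is convex if it has a supporting line at each of its points,
   i.e. it lies on one side of some line through that point. *)
Definition convex_curve (R : realType) (C : set (plane R)) : Prop :=
  forall u, C u -> exists a b : R, (a, b) <> (0, 0) /\
    forall v, C v -> 0 <= a * (v.1 - u.1) + b * (v.2 - u.2).

Definition contains_segment (R : realType) (C : set (plane R)) : Prop :=
  exists u v : plane R, u <> v /\
    forall s : R, s \in `[0, 1] -> C ((1 - s) *: u + s *: v).

(* Main.v *)
(* All upper bounds on rewards come from linear calibrations: by AM-GM,
   gamma(a, b) <= (1 + k) a + (1 + 1/k) b for every k > 0, with equality iff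
   b = k^2 a, so if gamma(x') / c <= A x1' + B x2' along a stretch of a path then
   its reward there is at most A and B times the increments of the coordinates.

   In the shifted model with r = 3/4 a path that meets the fast phase is cut at
   its first and last points on the line y = x - lambda; the three resulting
   bounds add up to 4 x + 4/3 y - 8/3 lambda.  For lambda = 0 this value is
   attained, by a diagonal segment followed by a segment of direction (1, 9), for
   all x <= y <= 9 x: Gamma is affine on this cone (flat edges) and has a kink on
   the diagonal (non-differentiability).  For lambda = 2 it equals
   gamma(4, 4) = 16 at (4, 4), so that the straight path and a three-piece path
   tie.  For lambda = 1, r = 1/12, Gamma = gamma on x < 1 while
   Gamma(5/4, 0) = 4, which breaks the convexity of the level curve of value 4.

   For a maximiser that starts along the axis, take c = 1 + y^(1/4).  Choosing
   k = y^(1/4) above bounds the reward by the increment of x + 4/3 y^(3/4), with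
   equality iff y' = sqrt y x' almost everywhere; the solutions of this
   differential equation through the origin wait on the x-axis and then follow a
   parabola, and the end point determines the waiting time. *)

Require Import Defs.
From HB Require Import structures.
From mathcomp Require Import all_boot all_order all_algebra.
From mathcomp Require Import all_classical all_reals all_analysis.
From mathcomp Require Import measurable_realfun ring lra.

Import Order.TTheory GRing.Theory Num.Theory.
Import numFieldNormedType.Exports.

Local Open Scope classical_set_scope.
Local Open Scope ring_scope.

(** * The fundamental theorem of calculus along piecewise C^1 functions *)

(** Reduces a property of intervals that survives concatenation to a single C^1 piece: induction on
    the breakpoints, cutting an interval at the last one inside it. *)
Lemma piecewise_C1_ind (R : realType) (f : R -> R) (P : R -> R -> Prop) :
  piecewise_C1 f ->
  (forall (u v : R) (g : R -> R), 0 <= u -> u <= v -> v <= 1 ->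
     {within `[u, v], continuous g} ->
     (forall s, s \in `]u, v[ ->
        derivable (f : R -> R^o) s 1 /\ derive1 (f : R -> R^o) s = g s) ->
     P u v) ->
  (forall u v w : R, 0 <= u -> u <= v -> v <= w -> w <= 1 ->
     P u v -> P v w -> P u w) ->
  forall u v : R, 0 <= u -> u <= v -> v <= 1 -> P u v.
Proof.
move=> [n [t [t0 tn tlt tC1]]] Ppiece Pcat.
have tle j k : (j <= k)%N -> (k <= n)%N -> t j <= t k.
  elim: k => [|k IHk]; first by rewrite leqn0 => /eqP ->.
  rewrite leq_eqVlt => /orP[/eqP -> //|jk kn].
  exact: le_trans (IHk jk (ltnW kn)) (ltW (tlt _ kn)).
suff main k : (k <= n)%N -> forall u v : R, 0 <= u -> u <= v -> v <= t k -> P u v.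
  by move=> u v u0 uv v1; apply: (main n) => //; rewrite tn.
elim: k => [_ u v u0 uv|k IHk kn u v u0 uv vk].
  rewrite t0 => v0; apply: (Ppiece _ _ (fun=> 0)) => //.
  - by rewrite (le_trans v0).
  - by apply: continuous_subspaceT => x; exact: cvg_cst.
  - by move=> s; rewrite in_itv/= => /andP[us sv]; lra.
have tk1 : t k.+1 <= 1 by rewrite -tn; exact: tle.
have t0k : 0 <= t k by rewrite -t0; apply: tle => //; exact: ltnW.
have [g [cg dg]] := tC1 k kn.
have piece a b : t k <= a -> a <= b -> b <= t k.+1 -> P a b.
  move=> ka ab bk.
  have sub : `[a, b]%classic `<=` `[t k, t k.+1]%classic.
    by apply: subset_itv; rewrite bnd_simp.
  have cg' := @continuous_subspaceW R R _ _ g sub cg.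
  apply: (Ppiece a b g (le_trans t0k ka) ab (le_trans bk tk1) cg').
  move=> s; rewrite in_itv/= => /andP[as_ sb]; rewrite derive1E.
  have stk : s \in `]t k, t k.+1[ by rewrite in_itv/= (le_lt_trans ka)// (lt_le_trans
    sb).
  by have [] := dg s stk.
have [vtk|tkv] := leP v (t k); first exact: (IHk (ltnW kn)).
have [tku|utk] := leP (t k) u; first exact: piece.
apply: (Pcat _ (t k)) => //.
- exact: ltW.
- exact: ltW.
- exact: le_trans tk1.
- by apply: (IHk (ltnW kn)) => //; exact: ltW.
- by apply: piece => //; exact: ltW.
Qed.

Lemma piecewise_C1_measurable_derive (R : realType) (f : R -> R) :
  piecewise_C1 f ->
  measurable_fun (`[0, 1] : set R) (derive1 (f : R -> R^o) : R -> R).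
Proof.
move=> pf; apply: (piecewise_C1_ind R f (fun u v => measurable_fun (`[u,
  v] : set R) (derive1 (f : R -> R^o) : R -> R))) => //.
- move=> u v g u0 uv v1 cg dg.
  (* [derive1] may take junk values at the two ends; two points do not affect measurability. *)
  apply: (@measurable_fun_itv_cc _ _ _ false true).
  apply: (@eq_measurable_fun _ _ _ _ `]u, v[%classic g).
    by move=> s; rewrite inE/= => suv; rewrite (dg s suv).2.
  apply: (measurable_funS (E := `[u, v]%classic)) => //.
    exact: subset_itv_oo_cc.
  exact: subspace_continuous_measurable_fun.
- move=> u v w u0 uv vw w1 m1 m2.
  rewrite (@itv_bndbnd_setU _ _ _ (BRight v)) ?bnd_simp//.
  apply/measurable_funU => //; split=> //.
  by apply: measurable_funS m2 => //; exact: subset_itv_oc_cc.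
Qed.

(** Chain rule and fundamental theorem on each piece; the increments telescope. Regularity of [phi]
    is asked only at values taken by [f], which admits potentials that are singular elsewhere. *)
Lemma piecewise_C1_FTC (R : realType) (f phi phi' : R -> R) (u v : R) :
  {within `[0, 1], continuous f} -> piecewise_C1 f ->
  0 <= u -> u <= v -> v <= 1 ->
  (forall s, s \in `[u, v] -> is_derive (f s) (1 : R) phi (phi' (f s)) /\
     {for f s, continuous phi'}) ->
  measurable_fun (`[u, v] : set R) (fun s => phi' (f s) * derive1 (f : R -> R^o) s) /\
  (\int[@lebesgue_measure R]_(s in `[u, v])
     (phi' (f s) * derive1 (f : R -> R^o) s)%:E = (phi (f v) - phi (f u))%:E)%E.
Proof.
move=> cf pf.
move: u v; apply: (piecewise_C1_ind R f) => // [u v g u0 uv v1 cg dg hphi|].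
  have cf' : {within `[u, v], continuous f}.
    by apply: continuous_subspaceW cf; apply: subset_itv; rewrite bnd_simp.
  have ch : {within `[u, v], continuous (fun s => phi' (f s) * g s)}.
    apply/subspace_continuousP => s suv; apply: cvgM.
      apply: (@cvg_comp _ _ _ f phi' _ (nbhs (f s))); last exact: (hphi s suv).2.
      exact: ((subspace_continuousP _ _).1 cf').
    exact: ((subspace_continuousP _ _).1 cg).
  have [->|uv'] := eqVneq u v.
    rewrite set_itv1 integral_set1 subrr; split => //.
    exact: measurable_fun_set1.
  have {uv'}uv' : u < v by rewrite lt_neqAle uv' uv.
  have e s : s \in `]u, v[ -> phi' (f s) * derive1 (f : R -> R^o) s = phi' (f s) * g s.
    by move=> suv; rewrite (dg s suv).2.
  have m : measurable_fun (`[u, v] : set R) (fun s => phi' (f s) * derive1 (f : R ->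
    R^o) s).
    apply: (@measurable_fun_itv_cc _ _ _ false true).
    apply: (@eq_measurable_fun _ _ _ _ `]u, v[%classic (fun s => phi' (f s) * g s)).
      by move=> s; rewrite inE/= => suv; rewrite e.
    apply: (measurable_funS (E := `[u, v]%classic)) => //.
      exact: subset_itv_oo_cc.
    exact: subspace_continuous_measurable_fun.
  split => //.
  (* The integrand agrees with a continuous function on the open piece only, which is all that the
     integral sees. *)
  rewrite (@eq_integral_itv_bounded _ _ _ (fun s => phi' (f s) * g s))//; last 2 first.
    by apply: measurable_funS m => //; exact: subset_itv_oo_cc.
    apply: (measurable_funS (E := `[u, v]%classic)) => //.
      exact: subset_itv_oo_cc.
    exact: subspace_continuous_measurable_fun.
  have [_ fu fv] := (continuous_within_itvP f uv').1 cf'.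
  have dphi s : s \in `[u, v] -> {for f s, continuous phi}.
    move=> /hphi[d _]; apply: differentiable_continuous.
    by have [/derivable1_diffP] := d.
  have d s : s \in `]u, v[ -> is_derive s (1 : R) (phi \o f) (phi' (f s) * g s).
    move=> suv; have h1 : is_derive s (1 : R) f (g s) by split;
      [exact: (dg s suv).1|rewrite -derive1E (dg s suv).2].
    have [h2 _] := hphi s (subset_itv_oo_cc suv).
    exact: (@is_derive1_comp _ phi f s _ _ h2 h1).
  have dpf : derivable_oo_LRcontinuous (phi \o f) u v.
    split.
    + by move=> x xuv; have [] := d x xuv.
    + by apply: continuous_cvg => //; apply: dphi; rewrite in_itv/= lexx uv.
    + by apply: continuous_cvg => //; apply: dphi; rewrite in_itv/= lexx uv.
  rewrite EFinB; apply: (continuous_FTC2 uv' ch dpf).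
  by move=> s suv; rewrite derive1E; have [_ ->] := d s suv.
move=> u v w u0 uv vw w1 m1 m2 h.
have [|m1' i1] := m1.
  move=> s; rewrite in_itv/= => /andP[us sv]; apply: h.
  by rewrite in_itv/= us (le_trans sv).
have [|{}m2 i2] := m2.
  move=> s; rewrite in_itv/= => /andP[vs sw]; apply: h.
  by rewrite in_itv/= sw andbT (le_trans uv).
have m2' : measurable_fun (`]v, w] : set R) (fun s => phi' (f s) * derive1 (f : R ->
  R^o) s).
  by apply: measurable_funS m2 => //; exact: subset_itv_oc_cc.
have m : measurable_fun (`[u, w] : set R) (fun s => phi' (f s) * derive1 (f : R ->
  R^o) s).
  rewrite (@itv_bndbnd_setU _ _ _ (BRight v)) ?bnd_simp//.
  exact/measurable_funU.
split => //.
rewrite (@itv_bndbnd_setU _ _ _ (BRight v)) ?bnd_simp//.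
rewrite integral_setU//; last 2 first.
- apply/measurable_EFinP; rewrite -itv_bndbnd_setU ?bnd_simp//.
- by apply/disj_setPS => x [/=]; rewrite !in_itv/= =>
    /andP[_ xv] /andP[/lt_le_trans /(_ xv)]; rewrite ltxx.
rewrite i1 integral_itv_obnd_cbnd; last exact/measurable_EFinP.
by rewrite i2 -EFinD; congr EFin; lra.
Qed.

(** * Paths and their rewards *)

(** The exceptional set is finite: the ends of the pieces. *)
Lemma piecewise_C1_derivable_ae (R : realType) (f : R -> R) :
  piecewise_C1 f ->
  {ae @lebesgue_measure R, forall s, s \in `[0, 1] ->
    (s \in `]0, 1[) /\ derivable (f : R -> R^o) s 1}.
Proof.
move=> pf.
have fin : finite_set [set s | (s \in `[0, 1]) /\ ~ derivable (f : R -> R^o) s 1].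
  apply: (piecewise_C1_ind R f (fun u v =>
     finite_set [set s | (s \in `[u, v]) /\ ~ derivable (f : R -> R^o) s 1])) => //.
  - move=> u v g _ _ _ _ dg; apply: (@sub_finite_set _ _ [set u; v]).
      move=> s [] /[!in_itv]/= /andP[]; rewrite !le_eqVlt.
      move=> /predU1P[->|us] /predU1P[->|sv] nd; [by left|by left|by right|].
      by case: nd; apply: (dg s _).1; rewrite in_itv/= us.
    by rewrite finite_setU; split; exact: finite_set1.
  - move=> u v w _ _ _ _ f1 f2; apply: (@sub_finite_set _ _ _ _ (_ : finite_set (_
      `|` _))); last first.
      by rewrite finite_setU; split; [exact: f1|exact: f2].
    move=> s [] /[!in_itv]/= /andP[us sw] nd.
    have [sv|vs] := leP s v; [left|right]; split=> //; rewrite in_itv/= ?us ?sv ?sw//.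
    by rewrite ltW.
have fin' : finite_set [set s | (s \in `[0, 1]) /\
    ~ ((s \in `]0, 1[) /\ derivable (f : R -> R^o) s 1)].
  apply: (@sub_finite_set _ _ ([set 0; 1] `|` _) _ (_ : finite_set _)); last first.
    rewrite finite_setU; split; last exact: fin.
    by rewrite finite_setU; split; exact: finite_set1.
  move=> s [] /= s01 nd.
  have [d|d] := pselect (derivable (f : R -> R^o) s 1); last by right.
  left; move: s01; rewrite in_itv/= !le_eqVlt.
  move=> /andP[/predU1P[<-|s0] /predU1P[->|s1]]; [by left|by left|by right|].
  by case: nd; split=> //; rewrite in_itv/= s0.
eexists; split.
- exact: countable_measurable (finite_set_countable fin').
- exact: countable_lebesgue_measure0 (finite_set_countable fin').
- by move=> s /= /not_implyP.
Qed.

Definition reward (R : realType) (c : plane R -> R) (p : R -> plane R) (s : R) : R :=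
  lpp_gamma (velocity p s) / c (p s).

Definition reward_on (R : realType) (c : plane R -> R) (p : R -> plane R)
    (u v : R) : \bar R :=
  (\int[@lebesgue_measure R]_(s in `[u, v]) (reward R c p s)%:E)%E.

(** The regularity of [c] on which the integral estimates rest. It is proved separately for each of
    the two kinds of speed function considered. *)
Definition path_measurable (R : realType) (c : plane R -> R) : Prop :=
  (forall w, 0 < c w) /\
  forall x y p, lpp_path x y p ->
    measurable_fun (`[0, 1] : set R) (fun s => (c (p s))^-1).

Lemma path_timeE (R : realType) (c : plane R -> R) p :
  path_time c p = reward_on R c p 0 1.
Proof. by []. Qed.

Lemma reward_ge0 (R : realType) (c : plane R -> R) p s :
  (forall w, 0 < c w) -> 0 <= reward R c p s.
Proof. by move=> c0; rewrite /reward/lpp_gamma divr_ge0 ?sqr_ge0// ltW. Qed.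

Lemma lpp_path_fst_cont (R : realType) (x y : R) p : lpp_path x y p ->
  {within `[0, 1], continuous (fun s => (p s).1 : R)}.
Proof.
move=> hp; apply/subspace_continuousP => s s01;
  apply: (@cvg_comp _ _ _ p fst _ (nbhs (p s)));
    last exact: (@cvg_fst _ _ (nbhs (p s).1) (nbhs (p s).2) _).
exact: ((subspace_continuousP _ _).1 (path_cont hp)).
Qed.

Lemma lpp_path_snd_cont (R : realType) (x y : R) p : lpp_path x y p ->
  {within `[0, 1], continuous (fun s => (p s).2 : R)}.
Proof.
move=> hp; apply/subspace_continuousP => s s01;
  apply: (@cvg_comp _ _ _ p snd _ (nbhs (p s)));
    last exact: (@cvg_snd _ _ (nbhs (p s).1) (nbhs (p s).2) _).
exact: ((subspace_continuousP _ _).1 (path_cont hp)).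
Qed.

Lemma velocity_ge0_ae (R : realType) (x y : R) p : lpp_path x y p ->
  {ae @lebesgue_measure R, forall s, s \in `[0, 1] ->
    [/\ s \in `]0, 1[, 0 <= (velocity p s).1 & 0 <= (velocity p s).2]}.
Proof.
move=> hp.
have d1 := piecewise_C1_derivable_ae R _ (path_C1_fst hp).
have d2 := piecewise_C1_derivable_ae R _ (path_C1_snd hp).
apply: (@filterS2 _ _ (ae_filter_ringOfSetsType (@lebesgue_measure R)) _ _ _ _ d1 d2)
  => s h1 h2 s01.
have [s01' ds1] := h1 s01; have [_ ds2] := h2 s01.
by have [] := path_monotone hp s01' ds1 ds2.
Qed.

Lemma measurable_sqrt (R : realType) : measurable_fun setT (@Num.sqrt R).
Proof. by apply: continuous_measurable_fun; exact: sqrt_continuous. Qed.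

Lemma reward_measurable (R : realType) (c : plane R -> R) (x y : R) p :
  path_measurable R c -> lpp_path x y p ->
  measurable_fun (`[0, 1] : set R) (reward R c p).
Proof.
move=> [_ mc] hp; apply: measurable_funM; last exact: mc hp.
apply: measurable_funX; apply: measurable_funD.
  apply: measurableT_comp; first exact: measurable_sqrt.
  exact: piecewise_C1_measurable_derive (path_C1_fst hp).
apply: measurableT_comp; first exact: measurable_sqrt.
exact: piecewise_C1_measurable_derive (path_C1_snd hp).
Qed.

(** * Calibration of path rewards *)

Lemma subitv01 (R : realType) (u v s : R) : 0 <= u -> v <= 1 ->
  s \in `[u, v] -> s \in `[0, 1].
Proof. by move=> u0 v1; rewrite !in_itv/= => /andP[us sv];
  rewrite (le_trans u0)// (le_trans sv). Qed.

(** Clipping the derivative at 0 changes it on a null set only and makes the integrand nonnegative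
    everywhere, as the integration lemmas for nonnegative functions require. *)
Lemma pos_derive_FTC (R : realType) (f phi phi' : R -> R) (u v : R) :
  {within `[0, 1], continuous f} -> piecewise_C1 f ->
  {ae @lebesgue_measure R, forall s, s \in `[0, 1] -> 0 <= derive1 (f : R -> R^o) s} ->
  0 <= u -> u <= v -> v <= 1 ->
  (forall s, s \in `[u, v] -> [/\ is_derive (f s) (1 : R) phi (phi' (f s)),
     {for f s, continuous phi'} & 0 <= phi' (f s)]) ->
  measurable_fun (`[u, v] : set R)
    (fun s => phi' (f s) * Num.max 0 (derive1 (f : R -> R^o) s)) /\
  (\int[@lebesgue_measure R]_(s in `[u, v])
     (phi' (f s) * Num.max 0 (derive1 (f : R ->
       R^o) s))%:E = (phi (f v) - phi (f u))%:E)%E.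
Proof.
move=> cf pf f0 u0 uv v1 h.
have [|m i] := piecewise_C1_FTC R f phi phi' u v cf pf u0 uv v1.
  by move=> s /h[].
have m' : measurable_fun (`[u, v] : set R)
    (fun s => phi' (f s) * Num.max 0 (derive1 (f : R -> R^o) s)).
  apply: (@eq_measurable_fun _ _ _ _ _ (fun s =>
    Num.max 0 (phi' (f s) * derive1 (f : R -> R^o) s))).
    by move=> s /set_mem /h[_ _ h0]; rewrite maxr_pMr// mulr0.
  exact: measurable_maxr.
split=> //; rewrite -i; apply: ae_eq_integral => //.
- exact/measurable_EFinP.
- exact/measurable_EFinP.
apply: (@filterS _ _ (ae_filter_ringOfSetsType (@lebesgue_measure R)) _ _ _ f0).
move=> s h0 /= suv; congr EFin; rewrite max_r//; apply: h0.
exact: subitv01 suv.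
Qed.

Lemma path_calibration (R : realType) (x y A : R) p (phi phi' : R -> R) (u v : R) :
  lpp_path x y p -> 0 <= u -> u <= v -> v <= 1 -> 0 <= A ->
  (forall s, s \in `[u, v] -> [/\ is_derive ((p s).2 : R) (1 : R) phi (phi' (p s).2),
     {for ((p s).2 : R), continuous phi'} & 0 <= phi' (p s).2]) ->
  measurable_fun (`[u, v] : set R) (fun s => A * Num.max 0 (velocity p s).1 +
       phi' (p s).2 * Num.max 0 (velocity p s).2) /\
  (\int[@lebesgue_measure R]_(s in `[u, v])
     (A * Num.max 0 (velocity p s).1 + phi' (p s).2 * Num.max 0 (velocity p s).2)%:E
   = (A * ((p v).1 - (p u).1) + (phi (p v).2 - phi (p u).2))%:E)%E.
Proof.
move=> hp u0 uv v1 A0 h.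
have v1ae : {ae @lebesgue_measure R, forall s, s \in `[0, 1] -> 0 <= (velocity p s).1}.
  apply: (@filterS _ _ (ae_filter_ringOfSetsType (@lebesgue_measure R)) _ _ _
    (velocity_ge0_ae R x y p hp)).
  by move=> s h0 /h0[].
have v2ae : {ae @lebesgue_measure R, forall s, s \in `[0, 1] -> 0 <= (velocity p s).2}.
  apply: (@filterS _ _ (ae_filter_ringOfSetsType (@lebesgue_measure R)) _ _ _
    (velocity_ge0_ae R x y p hp)).
  by move=> s h0 /h0[].
have [|m2 i2] := pos_derive_FTC R _ phi phi' u v (lpp_path_snd_cont R x y p hp)
  (path_C1_snd hp) v2ae u0 uv v1.
  by move=> s /h[].
have [|m1 i1] := pos_derive_FTC R _ (fun x => A * x) (fun=>
  A) u v (lpp_path_fst_cont R x y p hp) (path_C1_fst hp) v1ae u0 uv v1.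
  move=> s _; split => //; last exact: cvg_cst.
  by have := @is_deriveZ R R^o R^o id A (p s).1 1 1 _; rewrite /GRing.scale/= mulr1;
    apply; exact: is_derive_id.
split; first exact: measurable_funD.
under eq_integral do rewrite EFinD.
rewrite ge0_integralD//; last 4 first.
- by move=> s suv; rewrite lee_fin mulr_ge0// le_max lexx.
- exact/measurable_EFinP.
- by move=> s suv; have [_ _ p0] := h s suv; rewrite lee_fin mulr_ge0// le_max lexx.
- exact/measurable_EFinP.
by rewrite i1 i2 -EFinD; congr EFin; rewrite mulrBr.
Qed.

Lemma reward_on_cat (R : realType) (c : plane R -> R) (x y u v w : R) p :
  path_measurable R c -> lpp_path x y p ->
  0 <= u -> u <= v -> v <= w -> w <= 1 ->
  reward_on R c p u w = (reward_on R c p u v + reward_on R c p v w)%E.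
Proof.
move=> hc hp u0 uv vw w1; have m := reward_measurable R c x y p hc hp.
have m2 : measurable_fun (`[u, w] : set R) (fun s => (reward R c p s)%:E).
  apply/measurable_EFinP; apply: measurable_funS m => //.
  by move=> s; apply: subitv01.
rewrite /reward_on (@itv_bndbnd_setU _ _ _ (BRight v)) ?bnd_simp//.
rewrite integral_setU//; last 2 first.
- by rewrite -itv_bndbnd_setU ?bnd_simp.
- by apply/disj_setPS => s [/=]; rewrite !in_itv/= =>
    /andP[_ sv] /andP[/lt_le_trans /(_ sv)]; rewrite ltxx.
rewrite integral_itv_obnd_cbnd//; apply: measurable_funS m2 => //.
by move=> s/=; rewrite !in_itv/= => /andP[vs ->]; rewrite andbT (le_trans uv)// ltW.
Qed.

(** The two ends are discarded as well, so that a path cut at points of a discontinuity line need be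
    estimated only strictly between the cuts. *)
Lemma velocity_ge0_ae_oo (R : realType) (x y u v : R) p : lpp_path x y p ->
  0 <= u -> v <= 1 ->
  {ae @lebesgue_measure R, forall s, s \in `[u, v] ->
    [/\ s \in `]u, v[, 0 <= (velocity p s).1 & 0 <= (velocity p s).2]}.
Proof.
move=> hp u0 v1; have d1 := velocity_ge0_ae R x y p hp.
have d2 : {ae @lebesgue_measure R, forall s, ~ [set u; v] s}.
  have fin : finite_set [set u; v] by rewrite finite_setU; split; exact: finite_set1.
  exists [set u; v]; split.
  - exact: countable_measurable (finite_set_countable fin).
  - exact: countable_lebesgue_measure0 (finite_set_countable fin).
  - by move=> s /= /contrapT.
apply: (@filterS2 _ _ (ae_filter_ringOfSetsType (@lebesgue_measure R)) _ _ _ _ d1 d2).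
move=> s h1 h2 suv; have [_ ? ?] := h1 (subitv01 R u v s u0 v1 suv); split=> //.
move: suv; rewrite !in_itv/= !le_eqVlt => /andP[/predU1P[us|->] /predU1P[sv|->]] //;
  by case: h2; first [by left; rewrite us|by left|by right; rewrite sv|by right].
Qed.

(** The calibration principle: a pointwise bound of the reward by the differential of A x + phi(y)
    integrates to a bound by its increment. *)
Lemma reward_on_le (R : realType) (c : plane R -> R) (x y A : R) p
    (phi phi' : R -> R) (u v : R) :
  path_measurable R c -> lpp_path x y p ->
  0 <= u -> u <= v -> v <= 1 -> 0 <= A ->
  (forall s, s \in `[u, v] -> [/\ is_derive ((p s).2 : R) (1 : R) phi (phi' (p s).2),
     {for ((p s).2 : R), continuous phi'} & 0 <= phi' (p s).2]) ->
  (forall s, s \in `]u, v[ -> 0 <= (velocity p s).1 -> 0 <= (velocity p s).2 ->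
     reward R c p s <= A * (velocity p s).1 + phi' (p s).2 * (velocity p s).2) ->
  (reward_on R c p u v <=
     (A * ((p v).1 - (p u).1) + (phi (p v).2 - phi (p u).2))%:E)%E.
Proof.
move=> hc hp u0 uv v1 A0 hphi h.
have [m <-] := path_calibration R x y A p phi phi' u v hp u0 uv v1 A0 hphi.
have mr := reward_measurable R c x y p hc hp.
apply: ae_ge0_le_integral => //.
- by move=> s _; rewrite lee_fin reward_ge0//; case: hc.
- apply/measurable_EFinP; apply: measurable_funS mr => // s; exact: subitv01.
- move=> s suv; have [_ _ p0] := hphi s suv.
  by rewrite lee_fin addr_ge0// mulr_ge0// le_max lexx.
- exact/measurable_EFinP.
apply: (@filterS _ _ (ae_filter_ringOfSetsType (@lebesgue_measure R)) _ _ _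
  (velocity_ge0_ae_oo R x y u v p hp u0 v1)).
by move=> s hs /hs[suv v10 v20]; rewrite lee_fin !max_r//; exact: h.
Qed.

Lemma linear_calibration (R : realType) (B z : R) : 0 <= B ->
  [/\ is_derive z (1 : R) (fun y => B * y : R) B,
     {for z, continuous (fun=> B : R)} & 0 <= B].
Proof.
move=> B0; split => //; last exact: cvg_cst.
by have := @is_deriveZ R R^o R^o id B z 1 1 _; rewrite /GRing.scale/= mulr1; apply;
  exact: is_derive_id.
Qed.

Lemma reward_on_le_linear (R : realType) (c : plane R -> R) (x y A B : R) p
    (u v : R) :
  path_measurable R c -> lpp_path x y p ->
  0 <= u -> u <= v -> v <= 1 -> 0 <= A -> 0 <= B ->
  (forall s, s \in `]u, v[ -> 0 <= (velocity p s).1 -> 0 <= (velocity p s).2 ->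
     reward R c p s <= A * (velocity p s).1 + B * (velocity p s).2) ->
  (reward_on R c p u v <=
     (A * ((p v).1 - (p u).1) + B * ((p v).2 - (p u).2))%:E)%E.
Proof.
move=> hc hp u0 uv v1 A0 B0 h; rewrite (mulrBr B).
apply: (reward_on_le R c x y A p (fun y => B * y) (fun=> B)) => // s _.
exact: linear_calibration.
Qed.

(** Paths are monotone only through their velocity; by calibration with the potentials x and y,
    increments are integrals of nonnegative functions. *)
Lemma lpp_path_mono (R : realType) (x y : R) p : lpp_path x y p ->
  forall u v, 0 <= u -> u <= v -> v <= 1 ->
  (p u).1 <= (p v).1 /\ (p u).2 <= (p v).2.
Proof.
move=> hp u v u0 uv v1.
have [_ i1] := path_calibration R x y 1 p (fun y => 0 * y) (fun=> 0) u v hp u0 uv v1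
  ler01 (fun s _ => linear_calibration R 0 _ (lexx 0)).
have [_ i2] := path_calibration R x y 0 p (fun y => 1 * y) (fun=> 1) u v hp u0 uv v1
  (lexx 0) (fun s _ => linear_calibration R 1 _ ler01).
split; rewrite -subr_ge0 -lee_fin.
  move: i1; rewrite !mul0r subrr addr0 mul1r => <-.
  by apply: integral_ge0 => s _; rewrite lee_fin mul0r mul1r addr0 le_max lexx.
move: i2; rewrite !mul0r !mul1r add0r => <-.
by apply: integral_ge0 => s _; rewrite lee_fin mul0r mul1r add0r le_max lexx.
Qed.

(** With a and b the square roots of the coordinates, the difference of the two sides is (k a - b)^2
    / k. *)
Lemma lpp_gamma_le (R : realType) (k : R) (w : plane R) :
  0 < k -> 0 <= w.1 -> 0 <= w.2 ->
  lpp_gamma w <= (1 + k) * w.1 + (1 + k^-1) * w.2.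
Proof.
move=> k0 w10 w20; rewrite /lpp_gamma.
rewrite -{2}(sqr_sqrtr w10) -{2}(sqr_sqrtr w20).
set a := Num.sqrt _; set b := Num.sqrt _.
have : 0 <= k^-1 * (k * a - b) ^+ 2 by rewrite mulr_ge0 ?sqr_ge0// invr_ge0 ltW.
have -> : k^-1 * (k * a - b) ^+ 2 = k * a ^+ 2 - 2 * a * b + k^-1 * b ^+ 2.
  by field; rewrite gt_eqF.
by lra.
Qed.

(** * Hitting times and concrete paths *)

Lemma within_itv_near (R : realType) (f : R -> R) (P : R -> Prop) (a : R) :
  {within `[0, 1], continuous f} -> a \in `[0, 1] ->
  (\forall y \near f a, P y) ->
  exists2 e : R, 0 < e & forall s, s \in `[0, 1] -> `|s - a| < e -> P (f s).
Proof.
move=> cf a01 Pa.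
have := (subspace_continuousP _ _).1 cf a a01 _ Pa.
move=> /nbhs_ballP[e /= e0 he]; exists e => // s s01 sa.
by apply: he => //; rewrite /ball/= distrC.
Qed.

Lemma first_zero (R : realType) (f : R -> R) :
  {within `[0, 1], continuous f} -> 0 <= f 0 ->
  (exists2 s, s \in `[0, 1] & f s <= 0) ->
  exists a, [/\ a \in `[0, 1], f a = 0 & forall s, 0 <= s -> s < a -> 0 < f s].
Proof.
move=> cf f0 [s0 s001 fs0].
pose S := [set s | (s \in `[0, 1]) /\ f s <= 0].
have S0 : S !=set0 by exists s0.
have lbS : lbound S 0 by move=> s [+ _]; rewrite in_itv/= => /andP[].
have hlb : has_lbound S by exists 0.
pose a := inf S.
have a0 : 0 <= a by apply: lb_le_inf.
have a1 : a <= 1.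
  by apply: (le_trans (ge_inf hlb (conj s001 fs0))); move: s001; rewrite in_itv/= =>
    /andP[].
have a01 : a \in `[0, 1] by rewrite in_itv/= a0.
have pos s : 0 <= s -> s < a -> 0 < f s.
  move=> s_ge0 sa; rewrite ltNge; apply/negP => fs.
  have : a <= s by apply: ge_inf => //; split => //;
    rewrite in_itv/= s_ge0 (le_trans (ltW sa)).
  by rewrite leNgt sa.
exists a; split => //; apply/eqP; case: (ltgtP (f a) 0) => // fa.
  (* If f a < 0, then a > 0 and f is negative slightly before a, against the choice of the
     infimum. *)
  have [e e0 he] := within_itv_near R f (fun y =>
    y < 0) a cf a01 (@cvgr_lt R R (nbhs (f a)) _ id (f a) cvg_id 0 fa).
  have a_gt0 : 0 < a.
    by rewrite lt_neqAle a0 andbT; apply: contraTneq fa => <-; rewrite -leNgt.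
  pose d := Num.min (e / 2) a.
  have d0 : 0 < d by rewrite /d lt_min a_gt0 divr_gt0.
  have de : d <= e / 2 by rewrite ge_min lexx.
  have da : d <= a by rewrite ge_min lexx orbT.
  have : f (a - d) < 0.
    apply: he; first by rewrite in_itv/=; lra.
    by rewrite addrAC subrr add0r normrN gtr0_norm//; lra.
  by rewrite ltNge ltW// pos; lra.
(* If f a > 0, then f stays positive up to a + e, so the infimum would be at least a + e. *)
have [e e0 he] := within_itv_near R f (fun y =>
  0 < y) a cf a01 (@cvgr_gt R R (nbhs (f a)) _ id (f a) cvg_id 0 fa).
have : a + e <= inf S.
  apply: lb_le_inf => // s [s01 fs]; rewrite leNgt; apply/negP => sae.
  have as_ : a <= s by apply: ge_inf.
  have : 0 < f s by apply: he => //; rewrite ger0_norm; lra.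
  by rewrite ltNge fs.
by rewrite -/a; lra.
Qed.

(** Time reversal of [first_zero]. *)
Lemma last_zero (R : realType) (f : R -> R) :
  {within `[0, 1], continuous f} -> 0 <= f 1 ->
  (exists2 s, s \in `[0, 1] & f s <= 0) ->
  exists b, [/\ b \in `[0, 1], f b = 0 & forall s, b < s -> s <= 1 -> 0 < f s].
Proof.
move=> cf f1 [s0 s001 fs0].
have flip s : s \in `[0, 1] -> (1 - s : R) \in `[0, 1] by rewrite !in_itv/=; lra.
have [|||a [a01 fa ha]] := @first_zero R (fun s => f (1 - s)) _ _ _.
- apply/subspace_continuousP => s s01 P Pf.
  have := (subspace_continuousP _ _).1 cf (1 - s) (flip s s01) _ Pf.
  move=> Pn; rewrite /= /within/= in Pn *.
  have c : {for s, continuous (fun t : R => 1 - t)}.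
    by apply: (@continuousB _ R^o _ (cst (1 : R)) id s);
      [exact: cst_continuous|exact: cvg_id].
  apply: (@filterS _ (nbhs s) _ _ _ _ (c _ Pn)) => t /= h t01.
  by apply: h; exact: flip.
- by rewrite subr0.
- by exists (1 - s0); [exact: flip|rewrite subKr].
exists (1 - a); split => //; first exact: flip.
by move=> s bs s1; have := ha (1 - s); rewrite subKr; apply; lra.
Qed.

Lemma derive1_homo_ge0 (R : realType) (f : R -> R) (s : R) :
  {homo f : x y / x <= y} -> derivable (f : R -> R^o) s 1 ->
  0 <= derive1 (f : R -> R^o) s.
Proof.
move=> hf df; rewrite derive1E /derive; apply: limr_ge => //.
near=> h; rewrite /= /GRing.scale/= mulr1.
have : h != 0 by near: h; exact: nbhs_dnbhs_neq.
rewrite neq_lt => /orP[h0|h0].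
  by rewrite mulr_le0 ?invr_le0 ?(ltW h0)// subr_le0; apply: hf; lra.
by rewrite mulr_ge0 ?invr_ge0 ?(ltW h0)// subr_ge0; apply: hf; lra.
Unshelve. all: by end_near. Qed.

Lemma piecewise_derive1 (R : realType) (f F : R -> R) (a b s d : R) :
  s \in `]a, b[ -> (forall x, x \in `]a, b[ -> f x = F x) ->
  is_derive s (1 : R) F d -> is_derive s (1 : R) f d.
Proof.
move=> sab fF; apply: near_eq_is_derive.
have : \forall x \near s, x \in `]a, b[ by exact: near_in_itvoo.
by apply: filterS => x /fF.
Qed.

(** Each [G k] is continuous on the whole line, which supplies the one-sided limits at the
    breakpoints. *)
Lemma piecewise_C1_pieces (R : realType) (f : R -> R) (n : nat) (t : nat -> R)
    (F G : nat -> R -> R) :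
  t 0%N = 0 -> t n = 1 -> (forall k, (k < n)%N -> t k < t k.+1) ->
  (forall k s, (k < n)%N -> s \in `]t k, t k.+1[ -> f s = F k s) ->
  (forall k, (k < n)%N -> continuous (G k)) ->
  (forall k s, (k < n)%N -> s \in `]t k, t k.+1[ ->
    is_derive s (1 : R) (F k) (G k s)) ->
  piecewise_C1 f.
Proof.
move=> t0 tn tlt fF cG dF; exists n, t; split=> // k kn; exists (G k); split.
  by apply: continuous_subspaceT; exact: cG.
move=> s sk; apply: (piecewise_derive1 R f (F k) (t k) (t k.+1) s) => //;
  last exact: dF.
by move=> x xk; exact: fF.
Qed.

Lemma lpp_path_intro (R : realType) (f g : R -> R) :
  continuous f -> continuous g -> piecewise_C1 f -> piecewise_C1 g ->
  {homo f : x y / x <= y} -> {homo g : x y / x <= y} -> f 0 = 0 -> g 0 = 0 ->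
  lpp_path (f 1) (g 1) (fun s => (f s, g s) : plane R).
Proof.
move=> cf cg pf pg hf hg f0 g0; split => //.
- apply: continuous_subspaceT => s; exact: (cvg_pair (cf s) (cg s)).
- move=> s; rewrite in_itv/= => /andP[s0 _]; split => /=.
    by rewrite -f0; exact: hf.
  by rewrite -g0; exact: hg.
- by rewrite f0 g0.
- move=> s _ df dg; split.
    exact: (derive1_homo_ge0 R f s hf df).
  exact: (derive1_homo_ge0 R g s hg dg).
Qed.

Lemma reward_on_ge_cst (R : realType) (c : plane R -> R) (x y K : R) p (u v : R) :
  path_measurable R c -> lpp_path x y p -> 0 <= u -> u <= v -> v <= 1 -> 0 <= K ->
  (forall s, s \in `]u, v[ -> K <= reward R c p s) ->
  ((K * (v - u))%:E <= reward_on R c p u v)%E.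
Proof.
move=> hc hp u0 uv v1 K0 h.
have -> : (K * (v - u))%:E = (\int[@lebesgue_measure R]_(s in `[u, v]) (cst K%:E s))%E.
  rewrite integral_cst//= lebesgue_measure_itv/= lte_fin.
  move: uv; rewrite le_eqVlt => /predU1P[->|->]; last by rewrite -EFinB -EFinM.
  by rewrite ltxx subrr mulr0 mule0.
apply: ae_ge0_le_integral => //.
- by move=> s _; rewrite lee_fin reward_ge0//; case: hc.
- apply/measurable_EFinP; apply: measurable_funS (reward_measurable R c x y p hc hp)
    => //.
  by move=> s; exact: subitv01.
apply: (@filterS _ _ (ae_filter_ringOfSetsType (@lebesgue_measure R)) _ _ _
  (velocity_ge0_ae_oo R x y u v p hp u0 v1)).
by move=> s hs /hs[suv _ _]; rewrite lee_fin; exact: h.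
Qed.

Lemma Gamma_eq (R : realType) (c : plane R -> R) (x y v : R) :
  (exists2 p, lpp_path x y p & (v%:E <= path_time c p)%E) ->
  (forall q, lpp_path x y q -> (path_time c q <= v%:E)%E) ->
  Gamma c (x, y) = v.
Proof.
move=> [p hp vp] hq; rewrite /Gamma (_ : ereal_sup _ = v%:E)//.
apply/eqP; rewrite eq_le; apply/andP; split.
  by apply: ge_ereal_sup => _ [q /= /hq qv <-].
by apply: (le_trans vp); apply: ereal_sup_ubound; exists p.
Qed.

Lemma Gamma_le (R : realType) (c : plane R -> R) (x y v : R) :
  0 <= v -> (forall q, lpp_path x y q -> (path_time c q <= v%:E)%E) ->
  Gamma c (x, y) <= v.
Proof.
move=> v0 hq; rewrite /Gamma.
have : (ereal_sup [set path_time c p | p in lpp_path x y] <= v%:E)%E.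
  by apply: ge_ereal_sup => _ [q /= /hq qv <-].
(* The supremum over an empty set of paths is -oo, which [fine] sends to 0; this case uses 0 <=
   v. *)
by case: ereal_sup => [r| |] //=; rewrite lee_fin.
Qed.

(** * Three-piece polygonal paths *)

(** The piecewise linear function with increments a^2, b^2, c^2 on the three thirds of [0, 1]. The
    closed form with min and max makes continuity and monotonicity on the whole line immediate. *)
Definition ramp (R : realType) (a b c s : R) : R :=
  3 * (a ^+ 2 * Num.min s (1/3) + b ^+ 2 * (Num.min (Num.max s (1/3)) (2/3) - 1/3) +
       c ^+ 2 * (Num.max s (2/3) - 2/3)).

Definition ramp_piece (R : realType) (a b c : R) (k : nat) (s : R) : R :=
  match k with
  | 0%N => 3 * a ^+ 2 * s
  | 1%N => a ^+ 2 + 3 * b ^+ 2 * (s - 1/3)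
  | _ => a ^+ 2 + b ^+ 2 + 3 * c ^+ 2 * (s - 2/3)
  end.

Definition ramp_slope (R : realType) (a b c : R) (k : nat) : R :=
  match k with 0%N => 3 * a ^+ 2 | 1%N => 3 * b ^+ 2 | _ => 3 * c ^+ 2 end.

Lemma rampE (R : realType) (a b c : R) (k : nat) (s : R) : (k < 3)%N ->
  s \in `[k%:R / 3, k.+1%:R / 3] -> ramp R a b c s = ramp_piece R a b c k s.
Proof.
case: k => [|[|[|//]]] _; rewrite in_itv/= => /andP[ks sk]; rewrite /ramp /ramp_piece.
- have -> : Num.min s (1/3) = s by apply/min_idPl; lra.
  have -> : Num.max s (1/3) = 1/3 by apply/max_idPr; lra.
  have -> : Num.max s (2/3) = 2/3 by apply/max_idPr; lra.
  have -> : Num.min (1/3) (2/3) = 1/3 :> R by apply/min_idPl; lra.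
  by field.
- have -> : Num.min s (1/3) = 1/3 by apply/min_idPr; lra.
  have -> : Num.max s (1/3) = s by apply/max_idPl; lra.
  have -> : Num.max s (2/3) = 2/3 by apply/max_idPr; lra.
  have -> : Num.min s (2/3) = s by apply/min_idPl; lra.
  by field.
- have -> : Num.min s (1/3) = 1/3 by apply/min_idPr; lra.
  have -> : Num.max s (1/3) = s by apply/max_idPl; lra.
  have -> : Num.max s (2/3) = s by apply/max_idPl; lra.
  have -> : Num.min s (2/3) = 2/3 by apply/min_idPr; lra.
  by field.
Qed.

Lemma is_derive_affine (R : realType) (A B d s : R) :
  is_derive s (1 : R) (fun t : R => A + B * (t - d)) B.
Proof.
have h : is_derive s (1 : R) (fun t : R => B * t + (A - B * d)) (B + 0).
  apply: is_deriveD.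
  by have := @is_deriveZ R R^o R^o id B s 1 1 _; rewrite /GRing.scale/= mulr1; apply;
    exact: is_derive_id.
have -> : (fun t : R => A + B * (t - d)) = (fun t : R => B * t + (A - B * d)).
  by apply/funext => t; ring.
by rewrite addr0 in h.
Qed.

Lemma ramp_piece_derive (R : realType) (a b c : R) (k : nat) (s : R) :
  is_derive s (1 : R) (ramp_piece R a b c k) (ramp_slope R a b c k).
Proof.
case: k => [|[|k]]; last 2 first.
- exact: is_derive_affine.
- exact: is_derive_affine.
have := is_derive_affine R 0 (3 * a ^+ 2) 0 s.
by congr is_derive; apply/funext => t; rewrite add0r subr0.
Qed.

Lemma ramp_C1 (R : realType) (a b c : R) : piecewise_C1 (ramp R a b c).
Proof.
apply: (piecewise_C1_pieces R (ramp R a b c) 3 (fun k => k%:R / 3) (ramp_piece R a b c)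
  (fun k _ => ramp_slope R a b c k)) => //.
- by rewrite mul0r.
- by rewrite divff.
- by move=> k _; rewrite ltr_pM2r ?invr_gt0// ltr_nat.
- by move=> k s k3 sk; apply: rampE => //; exact: subset_itv_oo_cc sk.
- by move=> k _ x; exact: cvg_cst.
- by move=> k s _ _; exact: ramp_piece_derive.
Qed.

Lemma ramp_homo (R : realType) (a b c : R) : {homo ramp R a b c : x y / x <= y}.
Proof.
move=> x y xy; rewrite /ramp ler_pM2l//.
have minl (d : R) : Num.min x d <= Num.min y d.
  by rewrite le_min ge_min xy ge_min lexx orbT.
have maxl (d : R) : Num.max x d <= Num.max y d.
  by rewrite ge_max le_max xy le_max lexx orbT.
have minl2 (d e : R) : Num.min (Num.max x d) e <= Num.min (Num.max y d) e.
  by rewrite le_min ge_min maxl ge_min lexx orbT.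
by rewrite !lerD// ler_wpM2l ?sqr_ge0// lerD2r.
Qed.

Lemma ramp_cont (R : realType) (a b c : R) : continuous (ramp R a b c).
Proof.
move=> s; rewrite /continuous_at /ramp.
have cmin (f : R -> R) (d : R) : {for s, continuous f} ->
    Num.min (f x) d @[x --> s] --> Num.min (f s) d.
  by move=> cf; apply: (@continuous_min R R f (cst d)) => //; exact: cvg_cst.
have cmax (d : R) : Num.max x d @[x --> s] --> Num.max s d.
  by apply: (@continuous_max R R id (cst d)); [exact: cvg_id|exact: cvg_cst].
apply: cvgM; first exact: cvg_cst.
apply: cvgD; first apply: cvgD; apply: cvgM; try exact: cvg_cst.
- by apply: (cmin id); exact: cvg_id.
- by apply: cvgB; [apply: (cmin (fun x => Num.max x (1/3)));
    exact: cmax|exact: cvg_cst].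
- by apply: cvgB; [exact: cmax|exact: cvg_cst].
Qed.

(* The increments are (a1^2, b1^2), (a2^2, b2^2), (a3^2, b3^2), so that the
   rewards of the three pieces involve no square root. *)
Definition polyline (R : realType) (a1 b1 a2 b2 a3 b3 s : R) : plane R :=
  (ramp R a1 a2 a3 s, ramp R b1 b2 b3 s).

Lemma ramp0 (R : realType) (a b c : R) : ramp R a b c 0 = 0.
Proof. by rewrite (rampE R a b c 0)//= ?mulr0// in_itv/=; lra. Qed.

Lemma ramp1 (R : realType) (a b c : R) : ramp R a b c 1 = a ^+ 2 + b ^+ 2 + c ^+ 2.
Proof. by rewrite (rampE R a b c 2)//= ?in_itv/=; [field|lra]. Qed.

Lemma polyline_path (R : realType) (a1 b1 a2 b2 a3 b3 : R) :
  lpp_path (a1 ^+ 2 + a2 ^+ 2 + a3 ^+ 2) (b1 ^+ 2 + b2 ^+ 2 + b3 ^+ 2)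
    (polyline R a1 b1 a2 b2 a3 b3).
Proof.
rewrite -ramp1 -(ramp1 R b1).
apply: (lpp_path_intro R (ramp R a1 a2 a3) (ramp R b1 b2 b3)).
- exact: ramp_cont.
- exact: ramp_cont.
- exact: ramp_C1.
- exact: ramp_C1.
- exact: ramp_homo.
- exact: ramp_homo.
- exact: ramp0.
- exact: ramp0.
Qed.

Lemma ramp_derive1 (R : realType) (a b c : R) (k : nat) (s : R) : (k < 3)%N ->
  s \in `]k%:R / 3, k.+1%:R / 3[ ->
  derive1 (ramp R a b c : R -> R^o) s = ramp_slope R a b c k.
Proof.
move=> k3 sk; rewrite derive1E.
have fF x : x \in `]k%:R / 3, k.+1%:R / 3[ -> ramp R a b c x = ramp_piece R a b c k x.
  by move=> xk; apply: rampE => //; exact: subset_itv_oo_cc xk.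
by have [_ ->] := piecewise_derive1 R _ _ _ _ _ _ sk fF (ramp_piece_derive R a b c k s).
Qed.

Lemma lpp_gamma_sqr (R : realType) (a b m : R) : 0 <= a -> 0 <= b -> 0 <= m ->
  lpp_gamma ((m * a ^+ 2, m * b ^+ 2) : plane R) = m * (a + b) ^+ 2.
Proof.
move=> a0 b0 m0; rewrite /lpp_gamma/= (sqrtrM (a ^+ 2) m0) (sqrtrM (b ^+ 2) m0)
  !sqrtr_sqr !ger0_norm//.
by rewrite -mulrDr exprMn sqr_sqrtr.
Qed.

(** The velocity is constant on each third, so its reward is at least gamma of the increment times a
    lower bound for 1/c. Lower estimates suffice, as calibrations give the matching upper ones. *)
Lemma polyline_time (R : realType) (c : plane R -> R) (a1 b1 a2 b2 a3 b3 k1 k2 k3 : R) :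
  path_measurable R c -> 0 <= a1 -> 0 <= b1 -> 0 <= a2 -> 0 <= b2 -> 0 <= a3 ->
    0 <= b3 ->
  0 <= k1 -> 0 <= k2 -> 0 <= k3 ->
  let p := polyline R a1 b1 a2 b2 a3 b3 in
  (forall s, s \in `]0, 1/3[ -> k1 <= (c (p s))^-1) ->
  (forall s, s \in `]1/3, 2/3[ -> k2 <= (c (p s))^-1) ->
  (forall s, s \in `]2/3, 1[ -> k3 <= (c (p s))^-1) ->
  (((a1 + b1) ^+ 2 * k1 + (a2 + b2) ^+ 2 * k2 + (a3 + b3) ^+ 2 * k3)%:E <= path_time
    c p)%E.
Proof.
move=> hc a10 b10 a20 b20 a30 b30 k10 k20 k30 p h1 h2 h3.
have hp : lpp_path _ _ p := polyline_path R a1 b1 a2 b2 a3 b3.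
(* The factor 3 comes from the slope of [ramp] and cancels against the length 1/3. *)
have t1 : ((3 * (a1 + b1) ^+ 2 * k1 * (1/3 - 0))%:E <= reward_on R c p 0 (1/3))%E.
  apply: (reward_on_ge_cst R c _ _ _ p _ _ hc hp); try lra.
    by apply: mulr_ge0 => //; apply: mulr_ge0 => //; exact: sqr_ge0.
  move=> s sk; rewrite /reward ler_pM//; first (by apply: mulr_ge0 => //;
    exact: sqr_ge0); last exact: h1.
  rewrite /velocity /= !(ramp_derive1 R _ _ _ 0)//= ?mul0r//.
  by rewrite lpp_gamma_sqr.
have t2 : ((3 * (a2 + b2) ^+ 2 * k2 * (2/3 - 1/3))%:E <= reward_on R c p (1/3) (2/3))%E.
  apply: (reward_on_ge_cst R c _ _ _ p _ _ hc hp); try lra.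
    by apply: mulr_ge0 => //; apply: mulr_ge0 => //; exact: sqr_ge0.
  move=> s sk; rewrite /reward ler_pM//; first (by apply: mulr_ge0 => //;
    exact: sqr_ge0); last exact: h2.
  rewrite /velocity /= !(ramp_derive1 R _ _ _ 1)//=.
  by rewrite lpp_gamma_sqr.
have t3 : ((3 * (a3 + b3) ^+ 2 * k3 * (1 - 2/3))%:E <= reward_on R c p (2/3) 1)%E.
  apply: (reward_on_ge_cst R c _ _ _ p _ _ hc hp); try lra.
    by apply: mulr_ge0 => //; apply: mulr_ge0 => //; exact: sqr_ge0.
  move=> s sk; rewrite /reward ler_pM//; first (by apply: mulr_ge0 => //;
    exact: sqr_ge0); last exact: h3.
  rewrite /velocity /= !(ramp_derive1 R _ _ _ 2)//= ?divff//.
  by rewrite lpp_gamma_sqr.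
rewrite path_timeE (reward_on_cat R c _ _ 0 (2/3) 1 p hc hp); [|lra|lra|lra|lra].
rewrite (reward_on_cat R c _ _ 0 (1/3) (2/3) p hc hp); [|lra|lra|lra|lra].
apply: le_trans (leeD (leeD t1 t2) t3).
by rewrite -!EFinD lee_fin; lra.
Qed.

(** * Growth of Gamma in the shifted two-phase model *)

Lemma polyline_path_to (R : realType) (x y a1 b1 a2 b2 a3 b3 : R) :
  x = a1 ^+ 2 + a2 ^+ 2 + a3 ^+ 2 -> y = b1 ^+ 2 + b2 ^+ 2 + b3 ^+ 2 ->
  lpp_path x y (polyline R a1 b1 a2 b2 a3 b3).
Proof. by move=> -> ->; exact: polyline_path. Qed.

(** Along a path 1/c switches between two values according to a comparison of continuous
    functions. *)
Lemma shifted_path_measurable (R : realType) (lambda r : R) : 0 < r ->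
  path_measurable R (shifted_two_phase lambda r).
Proof.
move=> r0; split=> [w|x y p hp]; first by rewrite /shifted_two_phase; case: ifP.
apply: (@eq_measurable_fun _ _ _ _ _
  (fun s => if (p s).1 - lambda < (p s).2 then 1^-1 else r^-1)).
  by move=> s _; rewrite /shifted_two_phase; case: ifP.
apply: measurable_fun_if => //.
apply: measurable_fun_ltr.
  apply: measurable_funB => //.
  by apply: subspace_continuous_measurable_fun => //; exact: lpp_path_fst_cont hp.
by apply: subspace_continuous_measurable_fun => //; exact: lpp_path_snd_cont hp.
Qed.

Lemma shifted_inv_above (R : realType) (lambda r : R) w :
  w.1 - lambda < w.2 -> (shifted_two_phase lambda r w)^-1 = 1.
Proof. by rewrite /shifted_two_phase => ->; rewrite invr1. Qed.

Lemma shifted_inv_below (R : realType) (lambda r : R) w :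
  w.2 <= w.1 - lambda -> (shifted_two_phase lambda r w)^-1 = r^-1.
Proof. by rewrite /shifted_two_phase leNgt => /negbTE ->. Qed.

Lemma shifted_inv_le (R : realType) (lambda r : R) w : 0 < r -> r < 1 ->
  1 <= (shifted_two_phase lambda r w)^-1 <= r^-1.
Proof.
move=> r0 r1; have r1' : 1 <= r^-1 by rewrite invf_ge1// ltW.
by rewrite /shifted_two_phase; case: ifP; rewrite ?invr1 ?lexx ?r1'.
Qed.

Lemma reward_le_gamma (R : realType) (c : plane R -> R) (m k : R) p s :
  0 < k -> 0 <= (c (p s))^-1 <= m ->
  0 <= (velocity p s).1 -> 0 <= (velocity p s).2 ->
  reward R c p s <= m * (1 + k) * (velocity p s).1 + m * (1 + k^-1) * (velocity p s).2.
Proof.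
move=> k0 /andP[c0 cm] v1 v2; rewrite -!mulrA -mulrDr mulrC.
apply: ler_pM => //; first exact: sqr_ge0.
exact: lpp_gamma_le.
Qed.

Lemma phase_cont (R : realType) (lambda x y : R) p : lpp_path x y p ->
  {within `[0, 1], continuous (fun s => (p s).2 - (p s).1 + lambda : R)}.
Proof.
move=> hp; apply/subspace_continuousP => s s01; apply: cvgD; last exact: cvg_cst.
apply: cvgB.
  exact: ((subspace_continuousP _ _).1 (lpp_path_snd_cont R x y p hp)).
exact: ((subspace_continuousP _ _).1 (lpp_path_fst_cont R x y p hp)).
Qed.

Lemma above_bound (R : realType) (lambda r x y k : R) p : 0 < r -> 0 < k ->
  lpp_path x y p -> (forall s, s \in `[0, 1] -> (p s).1 - lambda < (p s).2) ->
  (path_time (shifted_two_phase lambda r) p <= ((1 + k) * x + (1 + k^-1) * y)%:E)%E.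
Proof.
move=> r0 k0 hp habove; have k0' : 0 < k^-1 by rewrite invr_gt0.
have -> : (1 + k) * x + (1 + k^-1) * y =
    (1 + k) * ((p 1).1 - (p 0).1) + (1 + k^-1) * ((p 1).2 - (p 0).2).
  by rewrite (path_end hp) (path_start hp)/= !subr0.
apply: (reward_on_le_linear R _ x y (1 + k) (1 + k^-1) p 0 1 _ hp) => //; try lra.
  exact: shifted_path_measurable.
move=> s s01 v1 v2.
have := reward_le_gamma R (shifted_two_phase lambda r) 1 k p s k0 _ v1 v2.
rewrite !mul1r; apply.
by rewrite shifted_inv_above ?ler01 ?lexx// habove//; exact: subset_itv_oo_cc s01.
Qed.

(* A path that meets the fast phase is bounded by splitting it at its first
   and last points on the line y = x - lambda, with A = 4/3, B = 4 before,
   A = B = 8/3 between and A = 4, B = 4/3 after; note that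
   4/3 + 4 = 8/3 + 8/3 = 4 + 4/3. *)
Lemma touching_bound (R : realType) (lambda x y : R) p : 0 <= lambda ->
  x - lambda <= y -> lpp_path x y p ->
  (exists2 s, s \in `[0, 1] & (p s).2 <= (p s).1 - lambda) ->
  (path_time (shifted_two_phase lambda (3/4)) p <=
     (4 * x + 4/3 * y - 8/3 * lambda)%:E)%E.
Proof.
move=> l0 xy hp [s0 s001 hs0].
have e0 := path_start hp; have e1 := path_end hp.
have cf := phase_cont R lambda x y p hp.
have ex : exists2 s, s \in `[0, 1] & (p s).2 - (p s).1 + lambda <= 0.
  by exists s0 => //; lra.
have [|a [a01 fa ha]] := first_zero R _ cf _ ex; first by rewrite e0/=; lra.
have [|b [b01 fb hb]] := last_zero R _ cf _ ex; first by rewrite e1/=; lra.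
move: a01 b01; rewrite !in_itv/= => /andP[a0 a1] /andP[b0 b1].
have ab : a <= b by rewrite leNgt; apply/negP => ba; have := hb a ba a1;
  rewrite fa ltxx.
have r0 : 0 < 3/4 :> R by lra.
have r1 : 3/4 < 1 :> R by lra.
have mc := shifted_path_measurable R lambda (3/4) r0.
have cpos s : 0 <= (shifted_two_phase lambda (3/4) (p s))^-1.
  by rewrite invr_ge0 ltW//; case: mc.
(* AM-GM with k = 1/3, 1, 3 gives the coefficient pairs (4/3, 4), (2, 2), (4, 4/3); the middle pair
   is multiplied by the largest value 4/3 of 1/c. *)
have k13 : 0 < 1/3 :> R by lra.
have k3 : 0 < 3 :> R by lra.
have i43 : (3/4)^-1 = 4/3 :> R by field.
have i13 : (1/3)^-1 = 3 :> R by field.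
have i1 : (reward_on R (shifted_two_phase lambda (3/4)) p 0 a <=
    (4/3 * ((p a).1 - (p 0).1) + 4 * ((p a).2 - (p 0).2))%:E)%E.
  apply: (reward_on_le_linear R _ x y _ _ p 0 a mc hp) => //; try lra.
  move=> s sab v1 v2.
  have /andP[s_ge0 sa] : 0 < s < a by move: sab; rewrite in_itv.
  have := reward_le_gamma R (shifted_two_phase lambda (3/4)) 1 (1/3) p s k13 _ v1 v2.
  rewrite i13 cpos shifted_inv_above; last by have := ha s (ltW s_ge0) sa; lra.
  by rewrite lexx => /(_ isT); lra.
have i2 : (reward_on R (shifted_two_phase lambda (3/4)) p a b <=
    (8/3 * ((p b).1 - (p a).1) + 8/3 * ((p b).2 - (p a).2))%:E)%E.
  apply: (reward_on_le_linear R _ x y _ _ p a b mc hp) => //; try lra.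
  move=> s _ v1 v2.
  have := reward_le_gamma R (shifted_two_phase lambda (3/4)) (4/3) 1 p s ltr01 _ v1 v2.
  have /andP[_] := shifted_inv_le R lambda (3/4) (p s) r0 r1.
  by rewrite invr1 cpos i43 => -> /(_ isT); lra.
have i3 : (reward_on R (shifted_two_phase lambda (3/4)) p b 1 <=
    (4 * ((p 1).1 - (p b).1) + 4/3 * ((p 1).2 - (p b).2))%:E)%E.
  apply: (reward_on_le_linear R _ x y _ _ p b 1 mc hp) => //; try lra.
  move=> s sab v1 v2.
  have /andP[bs s_lt1] : b < s < 1 by move: sab; rewrite in_itv.
  have := reward_le_gamma R (shifted_two_phase lambda (3/4)) 1 3 p s k3 _ v1 v2.
  rewrite cpos shifted_inv_above; last by have := hb s bs (ltW s_lt1); lra.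
  by rewrite lexx => /(_ isT); lra.
rewrite path_timeE (reward_on_cat R _ x y 0 b 1 p mc hp)//.
rewrite (reward_on_cat R _ x y 0 a b p mc hp)//.
apply: le_trans (leeD (leeD i1 i2) i3) _.
(* At both cuts x - y = lambda, and each of them contributes - 4/3 (x - y) to the sum. *)
by rewrite -!EFinD lee_fin e0 e1/=; lra.
Qed.

Lemma path_bounds (R : realType) (x y : R) p s : lpp_path x y p -> s \in `[0, 1] ->
  [/\ 0 <= (p s).1 <= x & 0 <= (p s).2 <= y].
Proof.
move=> hp s01; have [q1 q2] := path_quadrant hp s01.
move: s01; rewrite in_itv/= => /andP[s0 s1].
have [m1 m2] := lpp_path_mono R x y p hp s 1 s0 s1 (lexx 1).
by rewrite q1 q2; move: m1 m2; rewrite (path_end hp).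
Qed.

(** By monotonicity the abscissa never reaches lambda, so the path stays in the phase c = 1. *)
Lemma above_bound_lt (R : realType) (lambda r x y k : R) p : 0 < r -> 0 < k ->
  x < lambda ->
  lpp_path x y p ->
  (path_time (shifted_two_phase lambda r) p <= ((1 + k) * x + (1 + k^-1) * y)%:E)%E.
Proof.
move=> r0 k0 xl hp; apply: above_bound => // s s01.
by have [/andP[_ h1] /andP[h2 _]] := path_bounds R x y p s hp s01; lra.
Qed.

Lemma Gamma_left (R : realType) (lambda r a b : R) : 0 < r -> r < 1 -> 0 < a -> 0 < b ->
  a ^+ 2 < lambda ->
  Gamma (shifted_two_phase lambda r) (a ^+ 2, b ^+ 2) = (a + b) ^+ 2.
Proof.
move=> r0 r1 a0 b0 al; apply: Gamma_eq.
  exists (polyline R a b 0 0 0 0).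
    by apply: polyline_path_to; rewrite expr0n/= !addr0.
  have := @polyline_time R (shifted_two_phase lambda r) a b 0 0 0 0 1 0 0
    (shifted_path_measurable R lambda r r0) (ltW a0) (ltW b0) (lexx 0) (lexx 0) (lexx
      0) (lexx 0)
    ler01 (lexx 0) (lexx 0).
  rewrite !addr0 expr0n/= !mul0r !addr0 mulr1; apply => s _.
  - by have /andP[] := shifted_inv_le R lambda r (polyline R a b 0 0 0 0 s) r0 r1.
  - by rewrite invr_ge0 ltW//; case: (shifted_path_measurable R lambda r r0).
  - by rewrite invr_ge0 ltW//; case: (shifted_path_measurable R lambda r r0).
(* k = b / a is the equality case of AM-GM for the end point. *)
move=> q hq; have -> : (a + b) ^+ 2 = (1 + b / a) * a ^+ 2 + (1 + (b / a)^-1) * b ^+ 2.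
  by field; rewrite !gt_eqF.
by apply: above_bound_lt => //; rewrite divr_gt0.
Qed.

(** Monotonicity confines the path to the x-axis, where gamma(x', 0) = x': the rate is 1 up to
    abscissa lambda and at most 1/r beyond. *)
Lemma axis_bound (R : realType) (lambda r x : R) p : 0 < r -> r < 1 -> 0 <= lambda ->
  lambda <= x -> lpp_path x 0 p ->
  (path_time (shifted_two_phase lambda r) p <= (lambda + (x - lambda) / r)%:E)%E.
Proof.
move=> r0 r1 l0 lx hp; have mc := shifted_path_measurable R lambda r r0.
have e0 := path_start hp; have e1 := path_end hp.
have z s : s \in `[0, 1] -> (p s).2 = 0.
  by move=> s01; have [_ /andP[h1 h2]] := path_bounds R x 0 p s hp s01; lra.
have v2z s : s \in `]0, 1[ -> (velocity p s).2 = 0.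
  move=> s01; rewrite /velocity/= derive1E.
  have fF t : t \in `]0, 1[ -> (p t).2 = cst 0 t :> R.
    by move=> t01; apply: z; exact: subset_itv_oo_cc t01.
  by have [_ ->] := piecewise_derive1 R _ _ _ _ _ _ s01 fF (is_derive_cst (0 : R^o) s
    1).
have hr s : s \in `]0, 1[ -> 0 <= (velocity p s).1 ->
    reward R (shifted_two_phase lambda r) p s =
    (velocity p s).1 * (shifted_two_phase lambda r (p s))^-1.
  by move=> s01 v1; rewrite /reward/lpp_gamma v2z// sqrtr0 addr0 sqr_sqrtr.
have cf := phase_cont R lambda x 0 p hp.
have [||a [a01 fa ha]] := first_zero R _ cf.
- by rewrite e0/=; lra.
- by exists 1; [rewrite in_itv/=; lra|rewrite e1/=; lra].
have pa : (p a).1 = lambda by have := z a a01; lra.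
have /andP[a0 a1] : 0 <= a <= 1 by move: a01; rewrite in_itv.
have i1 : (reward_on R (shifted_two_phase lambda r) p 0 a <=
    (1 * ((p a).1 - (p 0).1) + 0 * ((p a).2 - (p 0).2))%:E)%E.
  apply: (reward_on_le_linear R _ x 0 _ _ p 0 a mc hp) => // s sab v1 v2.
  have /andP[s0 sa] : 0 < s < a by move: sab; rewrite in_itv.
  have s01 : s \in `]0, 1[ by rewrite in_itv/= s0 (lt_le_trans sa).
  rewrite hr// shifted_inv_above; first lra.
  by have := ha s (ltW s0) sa; lra.
have i2 : (reward_on R (shifted_two_phase lambda r) p a 1 <=
    (r^-1 * ((p 1).1 - (p a).1) + 0 * ((p 1).2 - (p a).2))%:E)%E.
  apply: (reward_on_le_linear R _ x 0 _ _ p a 1 mc hp) => //.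
    by rewrite invr_ge0 ltW.
  move=> s sab v1 v2.
  have /andP[as_ s1] : a < s < 1 by move: sab; rewrite in_itv.
  have s01 : s \in `]0, 1[ by rewrite in_itv/= s1 andbT (le_lt_trans a0).
  rewrite hr// mul0r addr0 mulrC ler_wpM2r//.
  by have /andP[] := shifted_inv_le R lambda r (p s) r0 r1.
rewrite path_timeE (reward_on_cat R _ x 0 0 a 1 p mc hp)//.
apply: le_trans (leeD i1 i2) _.
by rewrite -EFinD lee_fin e0 e1 pa/= !mul0r !addr0 mul1r subr0 mulrC.
Qed.

Lemma Gamma_axis (R : realType) : Gamma (shifted_two_phase 1 (1/12)) (5/4, 0) = 4 :> R.
Proof.
have r0 : 0 < 1/12 :> R by lra.
have r1 : 1/12 < 1 :> R by lra.
have i12 : (1/12)^-1 = 12 :> R by field.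
have cpos w : 0 <= (shifted_two_phase 1 (1/12) w : R)^-1.
  by have /andP[] := shifted_inv_le R 1 (1/12) w r0 r1; lra.
apply: Gamma_eq.
  (* Along the axis: reward 1 up to (1, 0), then 12 times the remaining length 1/4. *)
  exists (polyline R 1 0 (1/2) 0 0 0).
    by apply: polyline_path_to; field.
  have := @polyline_time R (shifted_two_phase 1 (1/12)) 1 0 (1/2) 0 0 0 1 12 0
    (shifted_path_measurable R 1 (1/12) r0) ler01 (lexx 0).
  have -> : ((1 + 0) ^+ 2 * 1 + (1 / 2 + 0) ^+ 2 * 12 + (0 + 0) ^+ 2 * 0)%R = 4 :> R
    by field.
  apply => //; try lra.
  - by move=> s _; have /andP[] :=
      shifted_inv_le R 1 (1/12) (polyline R 1 0 (1/2) 0 0 0 s) r0 r1.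
  - move=> s sab; have s2 : s \in `[1%:R / 3, 2%:R / 3] by exact: subset_itv_oo_cc sab.
    rewrite shifted_inv_below ?i12//= !(rampE R _ _ _ 1)//=.
    by move: s2; rewrite in_itv/=; lra.
move=> q hq; have -> : 4 = 1 + (5/4 - 1) / (1/12) :> R by field.
by apply: axis_bound => //; lra.
Qed.

(* The point (16/25, 36/25) of the level curve is interior to the triangle formed
   by (1/25, 81/25), (1/4, 9/4) and (5/4, 0), which lie on it too. *)
Lemma level_curve_not_convex (R : realType) :
  ~ convex_curve (level_curve (shifted_two_phase 1 (1/12)) (4 : R)).
Proof.
have r0 : 0 < 1/12 :> R by lra.
have r1 : 1/12 < 1 :> R by lra.
have left (a b : R) : 0 < a -> 0 < b -> a ^+ 2 < 1 -> a + b = 2 ->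
    level_curve (shifted_two_phase 1 (1/12)) 4 (a ^+ 2, b ^+ 2).
  move=> a0 b0 a1 ab; split; first by split; exact: sqr_ge0.
  by rewrite Gamma_left// ab; ring.
have P1 := left (1/5) (9/5) ltac:(lra) ltac:(lra) ltac:(lra) ltac:(lra).
have P2 := left (1/2) (3/2) ltac:(lra) ltac:(lra) ltac:(lra) ltac:(lra).
have P3 := left (4/5) (6/5) ltac:(lra) ltac:(lra) ltac:(lra) ltac:(lra).
have P4 : level_curve (shifted_two_phase 1 (1/12)) (4 : R) (5/4, 0).
  by split; [split => /=; lra|exact: Gamma_axis].
move=> /(_ _ P3)[a [b [ab h]]]; apply: ab.
have := h _ P1; have := h _ P2; have := h _ P4; rewrite /= => h4 h2 h1.
(* The vectors from (16/25, 36/25) to the other three points positively span the plane, so a linear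
   form nonnegative on all three vanishes. *)
have a0 : a = 0 by lra.
have b0 : b = 0 by lra.
by rewrite a0 b0.
Qed.

(** * The case lambda = 0, r = 3/4: an affine cone and a kink on the diagonal *)

Lemma Gamma_cone (R : realType) (x y : R) : 0 <= x -> x <= y -> y <= 9 * x ->
  Gamma (shifted_two_phase 0 (3/4)) (x, y) = 4 * x + 4/3 * y.
Proof.
move=> x0 xy yx.
have r0 : 0 < 3/4 :> R by lra.
have r1 : 3/4 < 1 :> R by lra.
have i43 : (3/4)^-1 = 4/3 :> R by field.
(* The coefficients of (x, y) = a^2 (1, 1) + b^2 (1, 9), nonnegative exactly on the cone. *)
pose a := Num.sqrt ((9 * x - y) / 8); pose b := Num.sqrt ((y - x) / 8).
have a2 : a ^+ 2 = (9 * x - y) / 8 by rewrite sqr_sqrtr//; lra.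
have b2 : b ^+ 2 = (y - x) / 8 by rewrite sqr_sqrtr//; lra.
have a0 : 0 <= a := sqrtr_ge0 _.
have b0 : 0 <= b := sqrtr_ge0 _.
have cpos w : 0 <= (shifted_two_phase 0 (3/4) w : R)^-1.
  by rewrite invr_ge0 ltW//; case: (shifted_path_measurable R 0 (3/4) r0).
apply: Gamma_eq.
  exists (polyline R a a b (3 * b) 0 0).
    by apply: polyline_path_to; rewrite ?exprMn a2 b2; field.
  have -> : 4 * x + 4/3 * y =
      (a + a) ^+ 2 * (4/3) + (b + 3 * b) ^+ 2 * 1 + (0 + 0) ^+ 2 * 0.
    have -> : (a + a) ^+ 2 = 4 * a ^+ 2 by ring.
    have -> : (b + 3 * b) ^+ 2 = 16 * b ^+ 2 by ring.
    by rewrite a2 b2; field.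
  apply: polyline_time => //; try lra.
  - exact: shifted_path_measurable.
  - move=> s sab; have s2 : s \in `[0%:R / 3, 1%:R / 3].
      by rewrite mul0r; exact: subset_itv_oo_cc sab.
    by rewrite shifted_inv_below ?i43//= !(rampE R _ _ _ 0)//= subr0.
  - move=> s sab; have /andP[] :=
      shifted_inv_le R 0 (3/4) (polyline R a a b (3 * b) 0 0 s) r0 r1; lra.
move=> q hq; have -> : 4 * x + 4/3 * y = 4 * x + 4/3 * y - 8/3 * 0 by ring.
apply: touching_bound => //; first lra.
(* For lambda = 0 the origin lies on the line, so every path meets it at time 0. *)
exists 0; first by rewrite in_itv/=; lra.
by rewrite (path_start hq)/= subr0.
Qed.

Lemma level_curve_segment (R : realType) :
  contains_segment (level_curve (shifted_two_phase 0 (3/4)) (16/3 : R)).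
Proof.
exists (1, 1), (1/2, 5/2); split.
  by move=> [+ _]; lra.
move=> s; rewrite in_itv/= => /andP[s0 s1].
have -> : (1 - s) *: ((1, 1) : plane R) + s *: ((1/2, 5/2) : plane R) =
   (1 - s / 2, 1 + 3/2 * s) :> plane R.
  by congr pair; rewrite /= /GRing.scale/=; field.
split; first by split => /=; lra.
by rewrite Gamma_cone; [field|lra|lra|lra].
Qed.

(** AM-GM with k = 1 and the largest value 4/3 of 1/c. The bound is attained on the diagonal, hence
    it controls the growth of [Gamma] when the diagonal is crossed. *)
Lemma Gamma_below_diag (R : realType) (x y : R) : 0 <= x -> 0 <= y ->
  Gamma (shifted_two_phase 0 (3/4)) (x, y) <= 8/3 * (x + y).
Proof.
move=> x0 y0.
have r0 : 0 < 3/4 :> R by lra.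
have r1 : 3/4 < 1 :> R by lra.
have i43 : (3/4)^-1 = 4/3 :> R by field.
apply: Gamma_le => [|p hp]; first lra.
have -> : 8/3 * (x + y) = 8/3 * ((p 1).1 - (p 0).1) + 8/3 * ((p 1).2 - (p 0).2).
  by rewrite (path_end hp) (path_start hp)/=; ring.
apply: (reward_on_le_linear R _ x y _ _ p 0 1 _ hp) => //; try lra.
  exact: shifted_path_measurable.
move=> s _ v1 v2.
have := reward_le_gamma R (shifted_two_phase 0 (3/4)) (4/3) 1 p s ltr01 _ v1 v2.
have /andP[c1] := shifted_inv_le R 0 (3/4) (p s) r0 r1.
rewrite invr1 i43 => ->; rewrite (le_trans ler01 c1) => /(_ isT).
by lra.
Qed.

(* Along the direction (1, -1) the right difference quotients at (1, 1) are
   nonpositive, while the left ones are 8/3. *)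
Lemma Gamma_not_differentiable (R : realType) :
  ~ differentiable (Gamma (shifted_two_phase 0 (3/4)) : plane R -> R^o) ((1,
    1) : plane R).
Proof.
set G := (Gamma (shifted_two_phase 0 (3/4)) : plane R -> R^o) => dG.
have dv := @diff_derivable R (plane R) R^o G ((1, 1) : plane R) ((1, -1) : plane R) dG.
pose o : plane R := (1, 1); pose d : plane R := (1, -1).
have G11 : G o = 16/3 by rewrite /G Gamma_cone; [field|lra|lra|lra].
pose q (h : R) : R := h^-1 * (G (h *: d + o) - G o).
pose l : R := 'D_d G o.
have ql : q @ 0^' --> l by exact: dv.
have Gh (h : R) : G (h *: d + o) = G (1 + h, 1 - h).
  by congr G; congr pair; rewrite /= /GRing.scale/=; ring.
have l_le0 : l <= 0.
  apply: (cvgr_to_le (cvg_dnbhs_at_right ql)); near=> h.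
  have h0 : 0 < h by near: h; exact: nbhs_right_gt.
  have h1 : h < 1 by near: h; exact: nbhs_right_lt.
  rewrite /q Gh G11 mulr_ge0_le0 ?invr_ge0 ?(ltW h0)// subr_le0.
  have := Gamma_below_diag R (1 + h) (1 - h); rewrite -/G; lra.
have l_ge : 8/3 <= l.
  apply: (cvgr_to_ge (cvg_dnbhs_at_left ql)); near=> h.
  have h0 : h < 0 by near: h; exact: nbhs_left_lt.
  (* This keeps (1 + h, 1 - h) in the cone x <= y <= 9 x, where [Gamma] is affine. *)
  have h1 : - (1/2) < h by near: h; apply: nbhs_left_gt; lra.
  rewrite /q Gh G11 /G Gamma_cone; [|lra|lra|lra].
  have -> : 4 * (1 + h) + 4/3 * (1 - h) - 16/3 = 8/3 * h by field.
  by rewrite mulrCA mulVf ?mulr1// lt_eqF.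
lra.
Unshelve. all: by end_near. Qed.

(** [Gamma] is 4 at (1/4, 9/4) and at (5/4, 0), but at most 289/80 at the intermediate point (4/5,
    81/80). The weight 9/20 makes y/x = (9/8)^2 there, so that k = 9/8 gives gamma exactly. *)
Lemma Gamma_not_concave (R : realType) :
  ~ concave_on (quadrant (R := R)) (Gamma (shifted_two_phase 1 (1/12))).
Proof.
have r0 : 0 < 1/12 :> R by lra.
have r1 : 1/12 < 1 :> R by lra.
have t0 : 0 <= 9/20 :> R by lra.
have t1 : 9/20 <= 1 :> R by lra.
have q1 : ((1/2) ^+ 2, (3/2) ^+ 2) \in (quadrant (R := R)).
  by rewrite inE; split; exact: sqr_ge0.
have q2 : (5/4, 0) \in (quadrant (R := R)) by rewrite inE; split => /=; lra.
move=> hconc.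
pose w : plane R := ((1/2) ^+ 2, (3/2) ^+ 2).
have h : - Gamma (shifted_two_phase 1 (1/12)) ((9/20 : R) *: w + (1 - 9/20 : R) *:
  ((5/4, 0) : plane R)) <=
  9/20 * - Gamma (shifted_two_phase 1 (1/12)) w + (1 - 9/20) * - Gamma
    (shifted_two_phase 1 (1/12)) (5/4, 0).
  exact: (hconc (Itv01 t0 t1) w (5/4, 0) q1 q2).
move: h; rewrite /w Gamma_axis (Gamma_left R 1 (1/12) (1/2) (3/2) r0 r1 ltac:(lra)
  ltac:(lra) ltac:(lra)).
have -> : (9/20 : R) *: (((1/2) ^+ 2, (3/2) ^+ 2) : plane R) +
    (1 - 9/20 : R) *: ((5/4, 0) : plane R) = (4/5, 81/80).
  by congr pair; rewrite /= /GRing.scale/=; field.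
have : Gamma (shifted_two_phase 1 (1/12)) (4/5,
  81/80) <= (1 + 9/8) * (4/5) + (1 + (9/8)^-1) * (81/80) :> R.
  apply: Gamma_le => [|p hp]; first by rewrite addr_ge0// mulr_ge0//; lra.
  by apply: above_bound_lt => //; lra.
have -> : (9/8)^-1 = 8/9 :> R by field.
lra.
Qed.

(** * Two maximisers for lambda = 2, r = 3/4 *)

Lemma two_maximisers (R : realType) : exists p q : R -> plane R,
  [/\ maximiser (shifted_two_phase 2 (3/4)) 4 4 p,
      maximiser (shifted_two_phase 2 (3/4)) 4 4 q & ~ same_curve p q].
Proof.
have r0 : 0 < 3/4 :> R by lra.
have r1 : 3/4 < 1 :> R by lra.
have i43 : (3/4)^-1 = 4/3 :> R by field.
have mc := shifted_path_measurable R 2 (3/4) r0.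
have cpos w : 0 <= (shifted_two_phase 2 (3/4) w : R)^-1 by rewrite invr_ge0 ltW//;
  case: mc.
have c1 w : 1 <= (shifted_two_phase 2 (3/4) w : R)^-1.
  by have /andP[] := shifted_inv_le R 2 (3/4) w r0 r1.
have ub p : lpp_path 4 4 p -> (path_time (shifted_two_phase 2 (3/4)) p <= (16 :
  R)%:E)%E.
  move=> hp.
  (* Paths that touch the line and paths that avoid it obey different bounds, both equal to 16 at
     (4, 4). *)
  have [ex|nex] := pselect (exists2 s, s \in `[0, 1] & (p s).2 <= (p s).1 - 2).
    have -> : 16 = 4 * 4 + 4/3 * 4 - 8/3 * 2 :> R by field.
    by apply: touching_bound => //; lra.
  have -> : 16 = (1 + 1) * 4 + (1 + 1^-1) * 4 :> R by field.
  apply: above_bound => // s s01; rewrite ltNge; apply/negP => h.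
  by apply: nex; exists s.
(* The second path enters the line y = x - 2 at (9/4, 1/4), follows it by the increment (3/2, 3/2)
   and leaves at (15/4, 7/4); its rewards are 4 + 8 + 4. *)
pose m := Num.sqrt (3/2 : R).
have m0 : 0 <= m := sqrtr_ge0 _.
have m2 : m ^+ 2 = 3/2 by rewrite sqr_sqrtr//; lra.
pose p := polyline R 2 2 0 0 0 0; pose q := polyline R (3/2) (1/2) m m (1/2) (3/2).
have hp : lpp_path 4 4 p by apply: polyline_path_to; ring.
have hq : lpp_path 4 4 q by apply: polyline_path_to; rewrite m2; field.
have tp : ((16 : R)%:E <= path_time (shifted_two_phase 2 (3/4)) p)%E.
  have -> : 16 = (2 + 2) ^+ 2 * 1 + (0 + 0) ^+ 2 * 0 + (0 + 0) ^+ 2 * 0 :> R by ring.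
  by apply: polyline_time => //; lra.
have tq : ((16 : R)%:E <= path_time (shifted_two_phase 2 (3/4)) q)%E.
  have -> : 16 = (3/2 + 1/2) ^+ 2 * 1 + (m + m) ^+ 2 * (4/3) + (1/2 + 3/2) ^+ 2 * 1
    :> R.
    have -> : (m + m) ^+ 2 = 4 * m ^+ 2 by ring.
    by rewrite m2; field.
  apply: polyline_time => //; try lra.
  move=> s sab; have s2 : s \in `[1%:R / 3, 2%:R / 3] by exact: subset_itv_oo_cc sab.
  by rewrite shifted_inv_below ?i43//= !(rampE R _ _ _ 1)//=; lra.
exists p, q; split.
- by split=> // q' /ub hq'; exact: le_trans tp.
- by split=> // q' /ub hq'; exact: le_trans tq.
move=> [phi [psi [[_ phi0 phi1 phim] [cpsi psi0 psi1 psim] h]]].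
(* When the second path is at (9/4, 1/4), the first one is on the diagonal. *)
have [|s s01 ps] := @IVT R psi 0 1 (1/3) ler01 cpsi.
  by rewrite psi0 psi1 ge_min le_max; lra.
have := h s s01; rewrite ps => /pair_equal_spec[].
have mem : (1/3 : R) \in `[0%:R / 3, 1%:R / 3] by rewrite in_itv/= mul0r lexx andbT;
  lra.
by rewrite (rampE R (3/2) _ _ 0)// (rampE R (1/2) _ _ 0)//= => -> ; lra.
Qed.

(** * The shifted two-phase model satisfies Assumptions A and B *)

(* The curves of [dcurve] live over bounded intervals, so the discontinuity line
   y = x - lambda is cut into countably many of them. *)
Definition phase_line (R : realType) (lambda : R) (i : nat) : dcurve R :=
  Graph (lambda + i%:R) (lambda + i.+1%:R) (fun s => s - lambda).

Lemma phase_lineP (R : realType) (lambda : R) (i : nat) (u : plane R) :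
  trace (phase_line R lambda i) u <->
  u.2 = u.1 - lambda /\ i%:R <= u.2 <= i.+1%:R.
Proof.
split => /=.
  by move=> [/andP[h1 h2] h3]; split=> //; apply/andP; split; lra.
by move=> [h3 /andP[h1 h2]]; split=> //; apply/andP; split; lra.
Qed.

Lemma phase_line_cover (R : realType) (lambda : R) (u : plane R) :
  0 <= u.2 -> u.2 = u.1 - lambda -> exists i, trace (phase_line R lambda i) u.
Proof.
move=> u0 e; exists (Num.truncn u.2); apply/phase_lineP; split=> //.
by have /andP[-> /ltW] := truncn_itv u0.
Qed.

Lemma nbhs_plane_lt (R : realType) (f : plane R -> R) (u : plane R) (a : R) :
  continuous f -> f u < a -> \forall v \near nbhs u, f v < a.
Proof. by move=> cf fu; exact: (@cvgr_lt R (plane R) (nbhs u) _ f (f u) (cf u) a fu).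
  Qed.

Lemma plane_fst_cont (R : realType) : continuous (fun u : plane R => u.1 : R).
Proof. by move=> u; exact: (@cvg_fst _ _ (nbhs u.1) (nbhs u.2) _). Qed.

Lemma plane_snd_cont (R : realType) : continuous (fun u : plane R => u.2 : R).
Proof. by move=> u; exact: (@cvg_snd _ _ (nbhs u.1) (nbhs u.2) _). Qed.

Lemma phase_diff_cont (R : realType) : continuous (fun u : plane R => u.1 - u.2 : R).
Proof.
by move=> u; apply: cvgB; [exact: plane_fst_cont|exact: plane_snd_cont].
Qed.

Lemma plane_ballP (R : realType) (w u : plane R) (e : R) :
  ball w e u <-> `|w.1 - u.1| < e /\ `|w.2 - u.2| < e.
Proof. by []. Qed.

Lemma compact_plane_bounded (R : realType) (K : set (plane R)) : compact K ->
  exists M : R, forall u, K u -> `|u.1| <= M /\ `|u.2| <= M.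
Proof.
move=> /compact_bounded[M [_ /(_ (M + 1))]]; rewrite ltrDl ltr01 => /(_ isT) h.
exists (M + 1) => u /h /=; rewrite prod_normE /= ge_max => /andP[].
by [].
Qed.

Lemma segment_connected_component (R : realType) (D : set (plane R)) (u v : plane R) :
  (forall s : R, s \in `[0, 1] -> D ((1 - s) *: u + s *: v)) ->
  connected_component D u = connected_component D v.
Proof.
move=> h; apply: same_connected_component.
pose f (s : R) : plane R := (1 - s) *: u + s *: v.
exists (f @` `[0, 1]); last by exists 1;
  [rewrite /= in_itv/= ler01 lexx|rewrite /f subrr scale0r scale1r add0r].
split.
- by exists 0; [rewrite /= in_itv/= ler01 lexx|rewrite /f subr0 scale0r scale1r addr0].
- by move=> _ [s s01 <-]; exact: h.
- apply: connected_continuous_connected; first exact: segment_connected.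
  apply: continuous_subspaceT => s; apply: cvgD.
    by apply: cvgZ; [apply: cvgB; [exact: cvg_cst|exact: cvg_id]|exact: cvg_cst].
  by apply: cvgZ; [exact: cvg_id|exact: cvg_cst].
Qed.

Lemma shifted_near (R : realType) (lambda r : R) (u : plane R) : u.2 <> u.1 - lambda ->
  \forall v \near nbhs u, shifted_two_phase lambda r v = shifted_two_phase lambda r u.
Proof.
move=> ne; have [h|h|//] := ltgtP u.2 (u.1 - lambda).
  have cN : continuous (fun u : plane R => - (u.1 - u.2)).
    by move=> x; apply: cvgN; exact: phase_diff_cont.
  have hN : - (u.1 - u.2) < - lambda by lra.
  apply: filterS (nbhs_plane_lt R _ u (- lambda) cN hN) => v vl.
  by rewrite /shifted_two_phase !ifF//; apply/negbTE; rewrite -leNgt; lra.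
have hP : u.1 - u.2 < lambda by lra.
apply: filterS (nbhs_plane_lt R _ u lambda (phase_diff_cont R) hP) => v vl.
by rewrite /shifted_two_phase !ifT//; lra.
Qed.

Lemma phase_line_free (R : realType) (lambda : R) (u : plane R) :
  (quadrant (R := R) `\` \bigcup_(i in setT) trace (phase_line R lambda i)) u <->
  quadrant u /\ u.2 <> u.1 - lambda.
Proof.
split=> [[qu nu]|[qu ne]]; split=> //.
  move=> e; apply: nu; have [i hi] := phase_line_cover R lambda u qu.2 e.
  by exists i.
by move=> [i _ /phase_lineP[]].
Qed.

(** Each phase is convex, so a point off the line is joined within its phase by a segment to (0, 1)
    or to (lambda + 1, 0). *)
Lemma phase_regions_finite (R : realType) (lambda : R) : 0 <= lambda ->
  finite_set (regions setT (phase_line R lambda)).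
Proof.
move=> l0; rewrite /regions.
set D := _ `\` _.
have hD u : D u <-> quadrant u /\ u.2 <> u.1 - lambda := phase_line_free R lambda u.
apply: (@sub_finite_set _ _ [set connected_component D (0, 1);
  connected_component D (lambda + 1, 0)]).
  move=> _ [u /hD[[u1 u2] ne] <-].
  have [h|h|//] := ltgtP u.2 (u.1 - lambda); [right|left];
    apply: segment_connected_component => s; rewrite in_itv/= => /andP[s0 s1];
    have s1' : 0 <= 1 - s by lra.
  - have h1 := mulr_ge0 s1' u1; have h2 := mulr_ge0 s1' u2; have h3 := mulr_ge0 s0 l0.
    have h4 : 0 <= (1 - s) * (u.1 - lambda - u.2) by rewrite mulr_ge0//; lra.
    apply/hD; split; first by split; rewrite /= /GRing.scale/=; lra.
    rewrite /= /GRing.scale/= => e; have s_0 : s = 0 by lra.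
    by move: e; rewrite s_0; lra.
  - have h1 := mulr_ge0 s1' u1; have h2 := mulr_ge0 s1' u2; have h3 := mulr_ge0 s1' l0.
    have h4 : 0 <= (1 - s) * (u.2 - (u.1 - lambda)) by rewrite mulr_ge0//; lra.
    have h5 := mulr_ge0 s0 l0.
    apply/hD; split; first by split; rewrite /= /GRing.scale/=; lra.
    rewrite /= /GRing.scale/= => e; have s_0 : s = 0 by lra.
    by move: e; rewrite s_0; lra.
by rewrite finite_setU; split; exact: finite_set1.
Qed.

Lemma phase_line_interior (R : realType) (lambda : R) (i : nat) (w : plane R) :
  trace (phase_line R lambda i) w -> ~ endpoint (phase_line R lambda i) w ->
  i%:R < w.2 < i.+1%:R.
Proof.
case: w => w1 w2 /phase_lineP[/= e /andP[]]; rewrite !le_eqVlt.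
move=> /predU1P[ei|->] /predU1P[ei'|->]//= ne; case: ne.
- by left; rewrite ei; congr pair; lra.
- by left; rewrite ei; congr pair; lra.
- by right; rewrite -ei'; congr pair; lra.
Qed.

Lemma phase_line_splits (R : realType) (lambda : R) (i : nat) (w : plane R) : 0 <=
  lambda ->
  trace (phase_line R lambda i) w -> ~ endpoint (phase_line R lambda i) w ->
  exists e, splits_ball (phase_line R lambda i) w e.
Proof.
move=> l0 tw ne; have /andP[iw wi] := phase_line_interior R lambda i w tw ne.
have [e _] := (phase_lineP _ _ _ _).1 tw.
have i0 : 0 <= i%:R :> R by [].
(* The vertical distance to the ends of the piece; as i >= 0 and lambda >= 0, the ball also stays in
   the quadrant. *)
exists (Num.min (w.2 - i%:R) (i.+1%:R - w.2)); split.
- by rewrite lt_min; lra.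
- move=> v /plane_ballP[]; rewrite !lt_min !ltr_norml => h1 h2; split; lra.
- move=> v /plane_ballP[]; rewrite !lt_min !ltr_norml => h1 h2.
  have [h|h|h] := ltgtP v.2 (v.1 - lambda).
  + by left; right; split => //; lra.
  + by left; left; split => //; lra.
  + by right; split => //; lra.
Qed.

Lemma shifted_assumption_A (R : realType) (lambda r : R) : 0 <= lambda -> 0 < r < 1 ->
  assumption_A (shifted_two_phase lambda r) setT (phase_line R lambda).
Proof.
move=> l0 /andP[r0 r1]; split.
- move=> i _; split.
    move=> u /phase_lineP[e /andP[h1 h2]].
    by have : 0 <= i%:R :> R by []; split; lra.
  split; first by rewrite ltrD2l ltr_nat.
    by apply: continuous_subspaceT => s; apply: cvgB; [exact: cvg_id|exact: cvg_cst].
  by apply: Or31; exists 1, (- lambda) => s _; rewrite mul1r.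
- move=> i w _ /phase_lineP[e /andP[h1 h2]] hc.
  have i0 : 0 <= i%:R :> R by [].
  have cw : shifted_two_phase lambda r w < 1.
    by rewrite /shifted_two_phase ifF// e ltxx.
  have : nbhs w (fun u => quadrant u -> shifted_two_phase lambda r u < 1).
    exact: hc _ (@cvgr_lt R R (nbhs (shifted_two_phase lambda r w)) _ id _ cvg_id 1 cw).
  move=> /nbhs_ballP[d /= d0 hd].
  (* Directly above the line c = 1, against c = r at w. *)
  have := hd (w.1, w.2 + d / 2).
  rewrite /shifted_two_phase/= ifT ?ltxx; last by rewrite e; lra.
  have q : quadrant ((w.1, w.2 + d / 2) : plane R) by split => /=; lra.
  move=> /(_ _ q) h; suff : false by []; apply: h.
  split; first by rewrite /ball/= subrr normr0.
  by rewrite /ball/= opprD addrA subrr add0r normrN gtr0_norm; lra.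
- move=> u [u1 u2]; exists (ball u 1); first exact: nbhsx_ballx.
  apply: (@sub_finite_set _ _ `I_(Num.truncn (u.2 + 1)).+1); last exact: finite_II.
  move=> i [_ [v [/phase_lineP[_ /andP[h1 h2]] /plane_ballP[_ b2]]]] /=.
  rewrite ltnS; move: b2; rewrite ltr_norml => /andP[b2 b3].
  by rewrite truncn_ge_nat; lra.
- move=> K _ _; apply: sub_finite_set (phase_regions_finite R lambda l0).
  by move=> U [].
- by move=> i w _ [tw ne _]; exact: phase_line_splits.
- move=> K cK _; have [M hM] := compact_plane_bounded R K cK.
  (* The points that are not interior are the junctions (lambda + n, n). *)
  pose g (n : nat) : plane R := (lambda + n%:R, n%:R).
  apply: (@sub_finite_set _ _ (g @` `I_(Num.truncn M).+2)); last first.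
    by apply: finite_image; exact: finite_II.
  move=> w [Kw [i [_ tw ni]]].
  have [e /andP[h1 h2]] := (phase_lineP _ _ _ _).1 tw.
  have [_ wM] := hM w Kw.
  suff [n wn] : exists n, w.2 = n%:R.
    exists n; last by rewrite /g -wn; case: (w) e => /= w1 w2 ->; congr pair; lra.
    rewrite /= ltnS; apply: leqW; rewrite truncn_ge_nat.
      by rewrite -wn; move: wM; rewrite ler_norml => /andP[].
    by apply: le_trans wM.
  have [->|ni1] := eqVneq w.2 i%:R; first by exists i.
  have [->|ni2] := eqVneq w.2 i.+1%:R; first by exists i.+1.
  (* A height strictly between i and i + 1 determines i, so no other piece passes through w. *)
  case: ni; split => // [[e'|e']|j _ ji /phase_lineP[_ /andP[j1 j2]]].
  + by case/eqP: ni1; rewrite e'/=; lra.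
  + by case/eqP: ni2; rewrite e'/=; lra.
  + have iw : i%:R < w.2 by rewrite lt_neqAle eq_sym ni1.
    have wi : w.2 < i.+1%:R by rewrite lt_neqAle ni2.
    have := lt_le_trans iw j2; have := le_lt_trans j1 wi; rewrite !ltr_nat.
    by rewrite !ltnS => a b; case: ji; apply/eqP; rewrite eqn_leq a b.
Qed.

Lemma shifted_assumption_B (R : realType) (lambda r : R) : 0 <= lambda -> 0 < r < 1 ->
  assumption_B (shifted_two_phase lambda r) setT (phase_line R lambda).
Proof.
move=> l0 /andP[r0 r1]; split.
- move=> _ [u _ <-]; apply: continuous_in_subspaceT =>
    x /set_mem/connected_component_sub.
  move=> /phase_line_free[_ ne];
    apply: (@near_cst_continuous _ _ (shifted_two_phase lambda r x)).
  exact: (shifted_near R lambda r x ne).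
- move=> x a ax.
  exists [set y | (a%:E < (shifted_two_phase lambda r y)%:E)%E]; last by [].
  have [qx|nqx] := pselect (quadrant (x : plane R)); last first.
    (* Outside the quadrant the subspace topology is discrete. *)
    by rewrite /nbhs/= -nbhs_subspace_out// => _ ->.
  rewrite /nbhs/= -nbhs_subspace_in// /within/=.
  have [e|ne] := eqVneq (x : plane R).2 ((x : plane R).1 - lambda); last first.
    apply: filterS (shifted_near R lambda r x (elimN eqP ne)) => y /= -> _.
    exact: ax.
  (* On the line c takes its minimum r, so every nearby value is at least as large. *)
  apply: filterS filterT => y _ /= _; apply: lt_le_trans ax _.
  rewrite lee_fin /shifted_two_phase e ltxx; case: ifP => // _.
  exact: ltW.
- move=> i w _ [tw ne _]; have [e he] := phase_line_splits R lambda i w l0 tw ne.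
  (* On the lower side c equals r, its value on the line. *)
  exists e, (lower (phase_line R lambda i) `&` ball w e); split => //; first by left.
  move=> y _ /phase_lineP[ey _] z hz _.
  have -> : shifted_two_phase lambda r y = r by rewrite /shifted_two_phase ey ltxx.
  have -> : (fun n => shifted_two_phase lambda r (z n)) = cst r.
    apply/funext => n; have [[_ /= h] _] := hz n.
    by rewrite /shifted_two_phase ifF//; apply/negbTE; rewrite -leNgt ltW.
  by move=> A /nbhs_singleton Ar; exists 0%N.
- move=> K _ _; exists r, 1; split => // u _.
  by rewrite /shifted_two_phase; case: ifP; rewrite ?lexx ?(ltW r1).
Qed.

Lemma shifted_speed_function (R : realType) (lambda r : R) : 0 <= lambda -> 0 < r < 1 ->
  speed_function (shifted_two_phase lambda r).
Proof.
move=> l0 r01; exists setT, (phase_line R lambda); split.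
- exact: shifted_assumption_A.
- exact: shifted_assumption_B.
Qed.

(** * A speed function with maximisers along the axis *)

Definition root4 (R : realType) (y : R) : R := Num.sqrt (Num.sqrt y).

Lemma root4_ge0 (R : realType) (y : R) : 0 <= root4 R y.
Proof. exact: sqrtr_ge0. Qed.

Lemma root4_gt0 (R : realType) (y : R) : 0 < y -> 0 < root4 R y.
Proof. by move=> y0; rewrite !sqrtr_gt0. Qed.

Lemma root4_sqr (R : realType) (y : R) : root4 R y ^+ 2 = Num.sqrt y.
Proof. by rewrite sqr_sqrtr// sqrtr_ge0. Qed.

Lemma root4_exp4 (R : realType) (y : R) : 0 <= y -> root4 R y ^+ 4 = y.
Proof. by move=> y0; rewrite (exprM _ 2 2) root4_sqr sqr_sqrtr. Qed.

Lemma root4_le (R : realType) (x y : R) : x <= y -> root4 R x <= root4 R y.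
Proof. by move=> xy; rewrite !ler_wsqrtr. Qed.

Lemma root4_cont (R : realType) : continuous (root4 R).
Proof.
move=> y; apply: continuous_comp; exact: sqrt_continuous.
Qed.

(** From (t + d)^4 >= t^4 + d^4. It measures the effect of shifting y by e = d^4. *)
Lemma root4_le_add (R : realType) (y d : R) : 0 <= y -> 0 <= d ->
  root4 R (y + d ^+ 4) <= root4 R y + d.
Proof.
move=> y0 d0; have t0 := root4_ge0 R y.
rewrite -(@ler_pXn2r _ 4)// ?nnegrE ?root4_ge0 ?addr_ge0//.
rewrite root4_exp4 ?addr_ge0 ?exprn_ge0// -{1}(root4_exp4 R y y0).
set t := root4 R y in t0 *.
have -> : (t + d) ^+ 4 = t ^+ 4 + d ^+ 4 + (4 * (t ^+ 3 * d) + 6 * (t ^+ 2 * d ^+ 2)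
  + 4 * (t * d ^+ 3)) by ring.
by rewrite lerDl !addr_ge0// mulr_ge0// mulr_ge0// exprn_ge0.
Qed.

Lemma is_derive_pow (R : realType) (n : nat) (x : R) :
  is_derive x (1 : R) (fun y : R => y ^+ n.+1) (n.+1%:R * x ^+ n).
Proof.
split; first exact: exprn_derivable.
by rewrite exp_derive /GRing.scale/= mulr1.
Qed.

(* The derivative of 4/3 y^(3/4) is 1/t with t = y^(1/4), and k = t is the choice
   in [lpp_gamma_le] for which the bound on gamma(a, b) / (1 + t) is a + b / t,
   an exact differential; the shift e > 0 removes the singularity at y = 0. *)
Definition axis_potential (R : realType) (k e y : R) : R :=
  k * (4/3 * root4 R (y + e) ^+ 3).

Lemma axis_potential_calibration (R : realType) (k e y : R) : 0 < k -> 0 < y + e ->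
  [/\ is_derive y (1 : R) (axis_potential R k e) (k * (root4 R (y + e))^-1),
     {for y, continuous (fun y => k * (root4 R (y + e))^-1)} &
     0 <= k * (root4 R (y + e))^-1].
Proof.
move=> k0 ye; have r0 := root4_gt0 R _ ye.
have s0 : 0 < Num.sqrt (y + e) by rewrite sqrtr_gt0.
split.
- have d1 : is_derive y (1 : R) (fun y : R => y + e) 1.
    have := is_derive_affine R e 1 0 y.
    by congr is_derive; apply/funext => t; ring.
  have d2 := @is_derive1_comp R Num.sqrt (fun y : R =>
    y + e) y _ _ (is_derive1_sqrt ye) d1.
  have d3 := @is_derive1_comp R Num.sqrt _ y _ _ (is_derive1_sqrt s0) d2.
  have d4 := @is_derive1_comp R (fun z => z ^+ 3) _ y _ _ (is_derive_pow R 2 _) d3.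
  have d5 := @is_derive1_comp R _ _ y _ _ (is_derive_affine R 0 (k * (4/3)) 0 _) d4.
  have -> : axis_potential R k e = (fun t : R => 0 + k * (4/3) * (t - 0)) \o
      ((fun z => z ^+ 3) \o (Num.sqrt \o (Num.sqrt \o (fun y : R => y + e)))).
    by apply/funext => t; rewrite /axis_potential /root4 /=; ring.
  apply: (is_derive_eq d5); rewrite /= -/(root4 R (y + e)) -root4_sqr.
  by field; rewrite gt_eqF.
- apply: cvgM; first exact: cvg_cst.
  apply: cvgV; first by rewrite gt_eqF.
  apply: (@cvg_comp _ _ _ (fun y => y + e) (root4 R) _ (nbhs (y + e)));
    last exact: root4_cont.
  by apply: cvgD; [exact: cvg_id|exact: cvg_cst].
- by rewrite mulr_ge0 ?invr_ge0 ?ltW.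
Qed.

(** Square roots of negative numbers being 0, this is positive and continuous on the whole plane. *)
Definition axis_speed (R : realType) (u : plane R) : R := 1 + root4 R u.2.

Lemma axis_speed_gt0 (R : realType) (u : plane R) : 0 < axis_speed R u.
Proof. by have := root4_ge0 R u.2; rewrite /axis_speed; lra. Qed.

Lemma axis_speed_cont (R : realType) : continuous (axis_speed R).
Proof.
move=> u; apply: cvgD; first exact: cvg_cst.
apply: (@cvg_comp _ _ _ (fun u : plane R => u.2 : R) (root4 R) _ (nbhs (u.2 : R))).
  exact: plane_snd_cont.
exact: root4_cont.
Qed.

Lemma axis_path_measurable (R : realType) : path_measurable R (axis_speed R).
Proof.
split=> [w|x y p hp]; first exact: axis_speed_gt0.
apply: subspace_continuous_measurable_fun => //.
apply/subspace_continuousP => s s01; apply: cvgV;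
  first by rewrite gt_eqF// axis_speed_gt0.
apply: (@cvg_comp _ _ _ p (axis_speed R) _ (nbhs (p s))); last exact: axis_speed_cont.
exact: ((subspace_continuousP _ _).1 (path_cont hp)).
Qed.

(** The speed is continuous, so the family of curves is empty (its map is a dummy), and the
    quadrant, star-shaped about the origin, is the only region. *)
Lemma axis_speed_function (R : realType) : speed_function (axis_speed R).
Proof.
exists set0, (fun=> VSeg (0 : R) 0 1); split; split => //.
- move=> u qu; exists setT; first exact: filterT.
  by apply: (@sub_finite_set _ _ set0) => // i [].
- move=> K _ _; rewrite /regions; set D := _ `\` _.
  have hD u : quadrant u -> D u by move=> qu; split=> // -[].
  apply: (@sub_finite_set _ _ [set connected_component D (0, 0)]);
    last exact: finite_set1.
  move=> _ [[u [[u1 u2] _] <-] _].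
  apply: segment_connected_component => s; rewrite in_itv/= => /andP[s0 s1].
  apply: hD; split; rewrite /= /GRing.scale/= mulr0 addr0 mulr_ge0//; lra.
- by move=> K _ _; apply: (@sub_finite_set _ _ set0) => // w [_ [i []]].
- by move=> U _; apply: continuous_subspaceT; exact: axis_speed_cont.
- move=> x a ax.
  exists [set y | (a%:E < (axis_speed R y)%:E)%E]; last by [].
  have [qx|nqx] := pselect (quadrant (x : plane R)); last first.
    by rewrite /nbhs/= -nbhs_subspace_out// => _ ->.
  rewrite /nbhs/= -nbhs_subspace_in// /within/=.
  have := @cvgr_gt R (plane R) (nbhs (x : plane R)) (nbhs_filter (x : plane R))
    (axis_speed R) _ (axis_speed_cont R x) a.
  rewrite -lte_fin => /(_ ax); apply: filterS => y /= ay _.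
  by rewrite lte_fin.
- move=> K cK _; have [M hM] := compact_plane_bounded R K cK.
  exists 1, (1 + root4 R M); split => // u Ku.
  have [_ uM] := hM u Ku.
  rewrite /axis_speed lerDl root4_ge0 lerD2l root4_le//.
  by apply: le_trans uM; exact: ler_norm.
Qed.

(** Lets the regularisation parameter tend to 0 in an upper bound for an integral that may be
    infinite a priori. *)
Lemma lee_right_limit (R : realType) (x : \bar R) (f : R -> R) :
  (forall d, 0 < d -> (x <= (f d)%:E)%E) -> {for 0, continuous f} -> (x <= (f 0)%:E)%E.
Proof.
case: x => [r| |] h cf; last by rewrite leNye.
  rewrite lee_fin; apply: (cvgr_to_ge (cvg_at_right_filter cf)); near=> d.
  by rewrite -lee_fin; apply: h; near: d; exact: nbhs_right_gt.
by have := h 1 ltr01; rewrite leye_eq.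
Unshelve. all: by end_near. Qed.

(** AM-GM gives (1 + k) (x' + y'/k), and 1 + k <= (1 + d) (1 + y^(1/4)). The margin d leaves room
    for a k that stays positive at y = 0. *)
Lemma axis_reward_le (R : realType) (p : R -> plane R) (s k d : R) :
  0 < k -> 0 <= d -> k <= root4 R (p s).2 + d ->
  0 <= (velocity p s).1 -> 0 <= (velocity p s).2 ->
  reward R (axis_speed R) p s <= (1 + d) * (velocity p s).1 + (1 + d) * k^-1 *
    (velocity p s).2.
Proof.
move=> k0 d0 kd v1 v2; have t0 := root4_ge0 R (p s).2.
rewrite /reward /axis_speed ler_pdivrMr; last by lra.
apply: le_trans (lpp_gamma_le R k _ k0 v1 v2) _.
set t := root4 R (p s).2 in t0 kd *.
have -> : (1 + k) * (velocity p s).1 + (1 + k^-1) * (velocity p s).2 =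
    ((velocity p s).1 + k^-1 * (velocity p s).2) * (1 + k).
  by field; rewrite gt_eqF.
have -> : ((1 + d) * (velocity p s).1 + (1 + d) * k^-1 * (velocity p s).2) * (1 + t) =
    ((velocity p s).1 + k^-1 * (velocity p s).2) * ((1 + d) * (1 + t)) by ring.
apply: ler_wpM2l; first by rewrite addr_ge0// mulr_ge0// invr_ge0 ltW.
by have := mulr_ge0 d0 t0; lra.
Qed.

(** Calibration with k = (y + d^4)^(1/4), which is positive and at most y^(1/4) + d, followed by d
    -> 0. *)
Lemma axis_reward_on_le (R : realType) (x y u v : R) (p : R -> plane R) :
  lpp_path x y p -> 0 <= u -> u <= v -> v <= 1 ->
  (reward_on R (axis_speed R) p u v <= ((p v).1 - (p u).1 +
    (axis_potential R 1 0 (p v).2 - axis_potential R 1 0 (p u).2))%:E)%E.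
Proof.
move=> hp u0 uv v1.
have pos s : s \in `[u, v] -> 0 <= (p s).2.
  by move=> suv; have [] := path_quadrant hp (subitv01 R u v s u0 v1 suv).
have uv1 : v \in `[u, v] by rewrite in_itv/= uv lexx.
have uv0 : u \in `[u, v] by rewrite in_itv/= uv lexx.
(* A polynomial in d that dominates the bound from the potential shifted by d^4. *)
pose f (d : R) := (1 + d) * ((p v).1 - (p u).1) +
   (1 + d) * (4/3 * (root4 R (p v).2 + d) ^+ 3 - 4/3 * root4 R (p u).2 ^+ 3).
have -> : (p v).1 - (p u).1 + (axis_potential R 1 0 (p v).2 - axis_potential R 1 0 (p
  u).2) = f 0.
  by rewrite /f /axis_potential !addr0; ring.
apply: lee_right_limit => [d d0|].
  have d4 : 0 < d ^+ 4 by rewrite exprn_gt0.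
  have d1 : 0 < 1 + d by lra.
  have := reward_on_le R (axis_speed R) x y (1 + d) p (axis_potential R (1 + d) (d ^+
    4))
    (fun y => (1 + d) * (root4 R (y + d ^+ 4))^-1) u v (axis_path_measurable R) hp u0
      uv v1 (ltW d1).
  move=> /(_ _ _)/le_trans; apply.
  - move=> s suv; apply: axis_potential_calibration => //.
    by have := pos s suv; lra.
  - move=> s suv w1 w2; apply: axis_reward_le => //.
    + by apply: root4_gt0; have := pos s (subset_itv_oo_cc suv); lra.
    + exact: ltW.
    + by apply: root4_le_add; [exact: pos (subset_itv_oo_cc suv)|exact: ltW].
  - rewrite lee_fin /f lerD2l /axis_potential -mulrBr ler_pM2l// lerB// ler_pM2l//.
      by rewrite lerXn2r ?nnegrE ?root4_ge0 ?addr_ge0 ?root4_ge0 ?(ltW d0)//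
        root4_le_add ?pos ?ltW.
    by rewrite lerXn2r ?nnegrE ?root4_ge0// root4_le// lerDl ltW.
rewrite /continuous_at /f.
have c1 : (1 + d : R) @[d --> (0:R)] --> (1 + 0 : R) by exact: cvgD (cvg_cst _) cvg_id.
apply: cvgD; first by apply: cvgM => //; exact: cvg_cst.
apply: cvgM => //; apply: cvgB; last exact: cvg_cst.
apply: cvgM; first exact: cvg_cst.
have c2 : (root4 R (p v).2 + d) @[d --> (0:R)] -->
  (root4 R (p v).2 + 0) by exact: cvgD (cvg_cst _) cvg_id.
exact: (@cvg_comp _ _ _ (fun d => root4 R (p v).2 + d) (fun z : R =>
  z ^+ 3) _ _ _ c2 (@exprn_continuous R 3 _)).
Qed.

(** * The path along the axis and the parabola, and its reward *)

Definition late (R : realType) (s : R) : R := Num.max 0 (2 * s - 1).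

(* The x-axis up to (1, 0), then the parabola x = 1 + 2 sqrt y, with
   parameter y^(1/4). *)
Definition axis_path (R : realType) (s : R) : plane R :=
  (2 * Num.min s (1/2) + 2 * late R s ^+ 2, late R s ^+ 4).

Lemma late_ge0 (R : realType) (s : R) : 0 <= late R s.
Proof. by rewrite /late le_max lexx. Qed.

Lemma late_early (R : realType) (s : R) : s <= 1/2 -> late R s = 0.
Proof. by move=> h; apply/max_idPl; lra. Qed.

Lemma late_late (R : realType) (s : R) : 1/2 <= s -> late R s = 2 * s - 1.
Proof. by move=> h; apply/max_idPr; lra. Qed.

Lemma late_homo (R : realType) : {homo late R : x y / x <= y}.
Proof. by move=> x y xy; rewrite /late ge_max !le_max lexx/=; apply/orP; right;
  lra. Qed.

Lemma late_cont (R : realType) : continuous (late R).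
Proof.
move=> s; apply: (@continuous_max R R (cst 0) (fun s => 2 * s - 1));
  first exact: cvg_cst.
by apply: cvgB; [apply: cvgM; [exact: cvg_cst|exact: cvg_id]|exact: cvg_cst].
Qed.

Lemma is_derive_affine_pow (R : realType) (k : R) (n : nat) (e s : R) :
  is_derive s (1 : R) (fun t => e + k * (2 * t - 1) ^+ n.+1)
    (2 * n.+1%:R * k * (2 * s - 1) ^+ n).
Proof.
have d1 := is_derive_affine R (-1) 2 0 s.
have d2 := @is_derive1_comp R _ _ s _ _ (is_derive_pow R n _) d1.
have d3 := @is_derive1_comp R _ _ s _ _ (is_derive_affine R e k 0 _) d2.
have -> : (fun t => e + k * (2 * t - 1) ^+ n.+1) = (fun t => e + k * (t - 0)) \o
    ((fun y => y ^+ n.+1) \o (fun t => -1 + 2 * (t - 0))).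
  by apply/funext => t /=; rewrite !subr0 (addrC (-1)).
apply: (is_derive_eq d3); rewrite /= subr0 (addrC (-1)); ring.
Qed.

Lemma affine_pow_cont (R : realType) (k : R) (n : nat) :
  continuous (fun s : R => k * (2 * s - 1) ^+ n).
Proof.
move=> s; apply: cvgM; first exact: cvg_cst.
apply: (@cvg_comp _ _ _ (fun s => 2 * s - 1) (fun z : R =>
  z ^+ n) _ _ _ _ (@exprn_continuous R n _)).
by apply: cvgB; [apply: cvgM; [exact: cvg_cst|exact: cvg_id]|exact: cvg_cst].
Qed.

Definition axis_fst (R : realType) (k : nat) (s : R) : R :=
  if k is 0%N then 2 * s else 1 + 2 * (2 * s - 1) ^+ 2.
Definition axis_snd (R : realType) (k : nat) (s : R) : R :=
  if k is 0%N then 0 else 0 + 1 * (2 * s - 1) ^+ 4.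
Definition axis_fst' (R : realType) (k : nat) (s : R) : R :=
  if k is 0%N then 2 else 2 * 2%:R * 2 * (2 * s - 1) ^+ 1.
Definition axis_snd' (R : realType) (k : nat) (s : R) : R :=
  if k is 0%N then 0 else 2 * 4%:R * 1 * (2 * s - 1) ^+ 3.

Lemma axis_fst_derive (R : realType) k s : is_derive s (1 : R) (axis_fst R k)
  (axis_fst' R k s).
Proof.
case: k => [|k]; last exact: is_derive_affine_pow.
have := is_derive_affine R 0 2 0 s.
by congr is_derive; apply/funext => t /=; ring.
Qed.

Lemma axis_snd_derive (R : realType) k s : is_derive s (1 : R) (axis_snd R k)
  (axis_snd' R k s).
Proof.
case: k => [|k]; last exact: is_derive_affine_pow.
exact: (is_derive_cst (0 : R^o) s 1).
Qed.

Lemma axis_pathE (R : realType) (k : nat) (s : R) : (k < 2)%N ->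
  s \in `[k%:R / 2, k.+1%:R / 2] -> axis_path R s = (axis_fst R k s, axis_snd R k s).
Proof.
case: k => [|[|//]] _; rewrite in_itv/= => /andP[ks sk]; rewrite /axis_path.
  by rewrite late_early// (min_idPl _)//; congr pair => /=; ring.
by rewrite late_late// (min_idPr _)//=; congr pair => /=; field.
Qed.

Lemma axis_path_C1 (R : realType) :
  piecewise_C1 (fun s => (axis_path R s).1 : R) /\ piecewise_C1 (fun s =>
    (axis_path R s).2 : R).
Proof.
have t2 : 2%:R / 2 = 1 :> R by rewrite divff.
have tlt k : (k < 2)%N -> k%:R / 2 < k.+1%:R / 2 :> R.
  by move=> _; rewrite ltr_pM2r ?invr_gt0// ltr_nat.
split.
  apply: (piecewise_C1_pieces R _ 2 (fun k =>
    k%:R / 2) (axis_fst R) (axis_fst' R)) => //.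
  - by rewrite mul0r.
  - by move=> k s k2 sk; rewrite (axis_pathE R k)//; exact: subset_itv_oo_cc sk.
  - by move=> [|k] _; [move=> x; exact: cvg_cst|exact: affine_pow_cont].
  - by move=> k s _ _; exact: axis_fst_derive.
apply: (piecewise_C1_pieces R _ 2 (fun k => k%:R / 2) (axis_snd R) (axis_snd' R)) => //.
- by rewrite mul0r.
- by move=> k s k2 sk; rewrite (axis_pathE R k)//; exact: subset_itv_oo_cc sk.
- by move=> [|k] _; [move=> x; exact: cvg_cst|exact: affine_pow_cont].
- by move=> k s _ _; exact: axis_snd_derive.
Qed.

Lemma axis_pathP (R : realType) : lpp_path 3 1 (axis_path R).
Proof.
have [C1 C2] := axis_path_C1 R.
pose f (s : R) := (axis_path R s).1 : R; pose g (s : R) := (axis_path R s).2 : R.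
have l1 : late R 1 = 1 by rewrite late_late; lra.
have l0 : late R 0 = 0 by rewrite late_early; lra.
have f1 : f 1 = 3 by rewrite /f /= l1 (min_idPr _)//; [field|lra].
have g1 : g 1 = 1 by rewrite /g /= l1 expr1n.
rewrite -[in X in lpp_path X _ _]f1 -[in X in lpp_path _ X _]g1.
have late_pow n : continuous (fun s => late R s ^+ n).
  move=> s; apply: (@cvg_comp _ _ _ (late R) (fun z : R =>
    z ^+ n) _ _ _ _ (@exprn_continuous R n _)).
  exact: late_cont.
have pow_homo n : {homo (fun s => late R s ^+ n) : x y / x <= y}.
  by move=> x y xy; rewrite lerXn2r ?nnegrE ?late_ge0// late_homo.
apply: (lpp_path_intro R f g) => //.
- move=> s; apply: cvgD; apply: cvgM; try exact: cvg_cst; last exact: late_pow.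
  by apply: (@continuous_min R R id (cst (1/2))); [exact: cvg_id|exact: cvg_cst].
- exact: late_pow.
- move=> x y xy; rewrite /f /= lerD// ler_pM2l//; last exact: pow_homo.
  by rewrite le_min ge_min xy ge_min lexx orbT.
- exact: pow_homo.
- by rewrite /f /= l0 (min_idPl _); [ring|lra].
- by rewrite /g /= l0 expr0n.
Qed.

Lemma axis_path_velocity (R : realType) (k : nat) (s : R) : (k < 2)%N ->
  s \in `]k%:R / 2, k.+1%:R / 2[ -> velocity (axis_path R) s = (axis_fst' R k s,
    axis_snd' R k s).
Proof.
move=> k2 sk; rewrite /velocity; congr pair; rewrite derive1E.
  have fF x : x \in `]k%:R / 2, k.+1%:R / 2[ -> (axis_path R x).1 = axis_fst R k x.
    by move=> xk; rewrite (axis_pathE R k)//; exact: subset_itv_oo_cc xk.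
  by have [_ ->] := piecewise_derive1 R _ _ _ _ _ _ sk fF (axis_fst_derive R k s).
have fF x : x \in `]k%:R / 2, k.+1%:R / 2[ -> (axis_path R x).2 = axis_snd R k x.
  by move=> xk; rewrite (axis_pathE R k)//; exact: subset_itv_oo_cc xk.
by have [_ ->] := piecewise_derive1 R _ _ _ _ _ _ sk fF (axis_snd_derive R k s).
Qed.

(** 13/3 is the value of x + 4/3 y^(3/4) at (3, 1): the axis yields 1 and the parabola 10/3. *)
Lemma axis_path_time (R : realType) :
  ((13/3 : R)%:E <= path_time (axis_speed R) (axis_path R))%E.
Proof.
have mc := axis_path_measurable R; have hp := axis_pathP R.
have i1 : ((2 * (1/2 - 0) : R)%:E <= reward_on R (axis_speed R) (axis_path R) 0
  (1/2))%E.
  apply: (reward_on_ge_cst R _ 3 1 2 _ 0 (1/2) mc hp) => //; try lra.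
  move=> s sk; have s0 : s \in `]0%:R / 2, 1%:R / 2[ by rewrite mul0r.
  rewrite /reward (axis_path_velocity R 0)// /axis_speed.
  rewrite (axis_pathE R 0)//; last exact: subset_itv_oo_cc s0.
  by rewrite /root4 /lpp_gamma/= !sqrtr0 !addr0 divr1 sqr_sqrtr.
have i2 : (reward_on R (axis_speed R) (axis_path R) (1/2) 1 = (10/3 : R)%:E)%E.
  (* With w = 2 s - 1 the velocity is (8 w, 8 w^3) and the speed 1 + w, so the reward is 8 w (1 +
     w); [F] is an antiderivative. *)
  pose h (s : R) := 8 * (2 * s - 1) ^+ 1 + 8 * (2 * s - 1) ^+ 2.
  pose F (s : R) := (0 + 2 * (2 * s - 1) ^+ 2) + (0 + 4/3 * (2 * s - 1) ^+ 3).
  have ch : continuous h by move=> s; apply: cvgD; exact: affine_pow_cont.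
  have dF s : is_derive s (1 : R) F (h s).
    have d := @is_deriveD R R^o R^o _ _ s 1 _ _ (is_derive_affine_pow R 2 1 0 s)
      (is_derive_affine_pow R (4/3) 2 0 s).
    have e : h s = 2 * 2%:R * 2 * (2 * s - 1) ^+ 1 + 2 * 3%:R * (4/3) * (2 * s - 1)
      ^+ 2.
      by rewrite /h; field.
    by rewrite e; exact: d.
  have rh s : s \in `]1/2, 1[ -> reward R (axis_speed R) (axis_path R) s = h s.
    move=> sk; have s1 : s \in `]1%:R / 2, 2%:R / 2[ by rewrite divff.
    rewrite /reward (axis_path_velocity R 1)// /axis_speed.
    rewrite (axis_pathE R 1)//; last exact: subset_itv_oo_cc s1.
    move: sk; rewrite in_itv/= => /andP[sl sr]; rewrite /h.
    have w0 : 0 <= 2 * s - 1 by lra.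
    set w := 2 * s - 1 in w0 *.
    have -> : (2 * 2 * 2 * w ^+ 1, 2 * 4 * 1 * w ^+ 3) = (8 * w * 1 ^+ 2,
      8 * w * w ^+ 2) :> plane R.
      by congr pair; ring.
    rewrite lpp_gamma_sqr//; last by rewrite mulr_ge0.
    have -> : root4 R (0 + 1 * w ^+ 4) = w.
      by rewrite add0r mul1r /root4 (exprM _ 2 2) sqrtr_sqr (ger0_norm (sqr_ge0 _))
        sqrtr_sqr ger0_norm.
    by field; rewrite gt_eqF// ltr_wpDr.
  have l12 : 1/2 < 1 :> R by lra.
  rewrite /reward_on (@eq_integral_itv_bounded _ _ _ h)//.
  - have -> : (10/3 : R)%:E = ((F 1)%:E - (F (1/2))%:E)%E.
      by rewrite -EFinB; congr EFin; rewrite /F; field.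
    apply: (continuous_FTC2 l12) => //.
    + exact: continuous_subspaceT.
    + have cF : continuous F.
        move=> s; apply: differentiable_continuous.
        by have [/derivable1_diffP] := dF s.
      split=> [s _||].
      * by have [] := dF s.
      * by apply: cvg_at_right_filter; exact: cF.
      * by apply: cvg_at_left_filter; exact: cF.
    + by move=> s _; rewrite derive1E; have [_ ->] := dF s.
  - apply: measurable_funS (reward_measurable R _ 3 1 _ mc hp) => // s.
    by rewrite /= !in_itv/=; lra.
  - apply: measurable_funTS; exact: continuous_measurable_fun.
rewrite path_timeE (reward_on_cat R _ 3 1 0 (1/2) 1 _ mc hp); [|lra|lra|lra|lra].
rewrite i2; apply: le_trans (leeD i1 (lexx _)).
by rewrite -EFinD lee_fin; lra.
Qed.

(** * The equality case and uniqueness of the maximiser *)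

Lemma axis_gamma_eq (R : realType) (t : R) (w : plane R) : 0 < t -> 0 <= w.1 ->
  0 <= w.2 ->
  w.1 + t^-1 * w.2 <= lpp_gamma w / (1 + t) -> w.1 = (t ^+ 2)^-1 * w.2.
Proof.
move=> t0 w1 w2; rewrite ler_pdivlMr; last by lra.
rewrite /lpp_gamma -{1 3}(sqr_sqrtr w1) -{1 3}(sqr_sqrtr w2).
set a := Num.sqrt _; set b := Num.sqrt _ => h.
(* The hypothesis bounds the AM-GM deficit by 0, whence b = t a. *)
have h2 : t^-1 * (t * a - b) ^+ 2 <= 0.
  have -> : t^-1 * (t * a - b) ^+ 2 = (a ^+ 2 + t^-1 * b ^+ 2) * (1 + t) - (a + b) ^+ 2.
    by field; rewrite gt_eqF.
  by lra.
move: h2; rewrite pmulr_rle0 ?invr_gt0// => h2.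
have /eqP : (t * a - b) ^+ 2 = 0 by apply/eqP; rewrite eq_le h2 sqr_ge0.
rewrite sqrf_eq0 subr_eq0 => /eqP <-.
by field; rewrite gt_eqF.
Qed.

Lemma sqrt_calibration (R : realType) (y : R) : 0 < y ->
  [/\ is_derive y (1 : R) (fun y => 2 * Num.sqrt y : R) ((Num.sqrt y)^-1),
     {for y, continuous (fun y => (Num.sqrt y)^-1 : R)} & 0 <= (Num.sqrt y)^-1].
Proof.
move=> y0; have s0 : 0 < Num.sqrt y by rewrite sqrtr_gt0.
split; last by rewrite invr_ge0 ltW.
- have d := @is_derive1_comp R _ _ y _ _ (is_derive_affine R 0 2 0 _)
    (is_derive1_sqrt y0).
  have -> : (fun y => 2 * Num.sqrt y : R) = (fun t => 0 + 2 * (t - 0)) \o Num.sqrt.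
    by apply/funext => t /=; rewrite add0r subr0.
  by apply: (is_derive_eq d); field; rewrite gt_eqF.
- by apply: cvgV; [rewrite gt_eqF|exact: sqrt_continuous].
Qed.

(** Here x and y are the rewards before and after a cut, a and b their bounds, z the deficit in the
    second bound. If the total attains a + b, nothing is lost. *)
Lemma ereal_squeeze (R : realType) (a b : R) (x y z : \bar R) :
  (0 <= y)%E -> (0 <= z)%E -> b%:E = (y + z)%E -> (x <= a%:E)%E ->
  ((a + b)%:E <= x + y)%E -> z = 0%E.
Proof.
case: x y z => [x| |] [y| |] [z| |] //= y0 z0 [] byz; rewrite !lee_fin => xa xy.
by congr EFin; move: z0 xy; rewrite lee_fin; lra.
Qed.

(* An optimal path has equality in AM-GM almost everywhere, so x' = y' / sqrt y
   wherever y > 0, and x - 2 sqrt y is constant there. *)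
Lemma axis_optimal_parabola (R : realType) (q : R -> plane R) (u : R) :
  lpp_path 3 1 q -> ((13/3 : R)%:E <= path_time (axis_speed R) q)%E ->
  0 <= u -> u <= 1 -> 0 < (q u).2 -> (q u).1 = 1 + 2 * Num.sqrt (q u).2.
Proof.
move=> hq tq u0 u1 qu0; have mc := axis_path_measurable R.
have e0 := path_start hq; have e1 := path_end hq.
have pos s : s \in `[u, 1] -> 0 < (q s).2.
  rewrite in_itv/= => /andP[us s1]; apply: lt_le_trans qu0 _.
  by have [] := lpp_path_mono R 3 1 q hq u s u0 us s1.
have cal s : s \in `[u, 1] -> [/\ is_derive ((q s).2 : R) (1 : R) (axis_potential R 1
  0) (1 * (root4 R ((q s).2 + 0))^-1),
     {for ((q s).2 : R), continuous (fun y => 1 * (root4 R (y + 0))^-1)} &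
     0 <= 1 * (root4 R ((q s).2 + 0))^-1].
  by move=> su; apply: axis_potential_calibration => //; rewrite addr0; exact: pos.
have [mh ih] := path_calibration R 3 1 1 q (axis_potential R 1 0)
  (fun y => 1 * (root4 R (y + 0))^-1) u 1 hq u0 u1 (lexx 1) ler01 cal.
pose h s := 1 * Num.max 0 (velocity q s).1 + 1 * (root4 R ((q s).2 + 0))^-1 * Num.max
  0 (velocity q s).2.
have h0 s : s \in `[u, 1] -> 0 <= h s.
  by move=> /cal[_ _ p0]; rewrite addr_ge0// mulr_ge0// le_max lexx.
pose D := reward R (axis_speed R) q.
have D0 s : 0 <= D s by apply: reward_ge0 => w; exact: axis_speed_gt0.
have mD : measurable_fun (`[u, 1] : set R) D.
  apply: measurable_funS (reward_measurable R _ 3 1 q mc hq) => // s.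
  by apply: subitv01.
(* The pointwise deficit of the calibration, clipped so as to be nonnegative also on the exceptional
   null set. *)
pose g s := Num.max 0 (h s - D s).
have mg : measurable_fun (`[u, 1] : set R) g.
  by apply: measurable_maxr => //; exact: measurable_funB.
have g0 s : 0 <= g s by rewrite /g le_max lexx.
have good := velocity_ge0_ae_oo R 3 1 u 1 q hq u0 (lexx 1).
have kpos s : s \in `[u, 1] -> 0 < root4 R (q s).2 by move=> /pos; exact: root4_gt0.
have Dh s : s \in `[u, 1] -> 0 <= (velocity q s).1 -> 0 <= (velocity q s).2 ->
  D s <= h s.
  move=> su v1 v2; rewrite /h !max_r//.
  have := axis_reward_le R q s (root4 R (q s).2) 0 (kpos s su) (lexx 0) _ v1 v2.
  by rewrite !addr0 lexx; apply.
have hD : (\int[@lebesgue_measure R]_(s in `[u, 1%R]) (h s)%:E =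
    \int[@lebesgue_measure R]_(s in `[u, 1%R]) (D s)%:E +
    \int[@lebesgue_measure R]_(s in `[u, 1%R]) (g s)%:E)%E.
  rewrite -ge0_integralD//; last 4 first.
  - by move=> s _; rewrite lee_fin.
  - exact/measurable_EFinP.
  - by move=> s _; rewrite lee_fin.
  - exact/measurable_EFinP.
  apply: ae_eq_integral => //.
  - exact/measurable_EFinP.
  - by apply: emeasurable_funD; exact/measurable_EFinP.
  apply: (@filterS _ _ (ae_filter_ringOfSetsType (@lebesgue_measure R)) _ _ _ good).
  move=> s hs su; have [_ v1 v2] := hs su.
  by rewrite -EFinD /g max_r ?subr_ge0 ?Dh// addrC subrK.
have W0 : axis_potential R 1 0 0 = 0.
  by rewrite /axis_potential addr0 /root4 !sqrtr0 expr0n/= !mulr0.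
have W1 : axis_potential R 1 0 1 = 4/3.
  by rewrite /axis_potential addr0 /root4 !sqrtr1 expr1n; ring.
have intg0 : (\int[@lebesgue_measure R]_(s in `[u, 1%R]) (g s)%:E = 0)%E.
  (* The bounds before and after u add up to 13/3, which q attains. *)
  have J1 := axis_reward_on_le R 3 1 0 u q hq (lexx 0) u0 u1.
  apply: (ereal_squeeze R _ _ _ _ _ _ _ (etrans (esym ih) hD) J1).
  - by apply: integral_ge0 => s _; rewrite lee_fin.
  - by apply: integral_ge0 => s _; rewrite lee_fin.
  - apply: le_trans (le_trans tq _).
      by rewrite lee_fin e0 e1 /= W0 W1; lra.
    by rewrite path_timeE (reward_on_cat R _ 3 1 0 u 1 q mc hq).
(* Zero deficit means x' = y' / sqrt y almost everywhere. The terms with coefficient 0 put both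
   sides in the form of [path_calibration]. *)
have hv : (\int[@lebesgue_measure R]_(s in `[u,
  1%R]) (1 * Num.max 0 (velocity q s).1 + 0 * Num.max 0 (velocity q s).2)%:E =
  \int[@lebesgue_measure R]_(s in `[u,
    1%R]) (0 * Num.max 0 (velocity q s).1 + (Num.sqrt (q s).2)^-1 * Num.max 0
      (velocity q s).2)%:E)%E.
  have [m1 _] := path_calibration R 3 1 1 q (fun y => 0 * y) (fun=>
    0) u 1 hq u0 u1 (lexx 1) ler01
    (fun s _ => linear_calibration R 0 _ (lexx 0)).
  have [m2 _] := path_calibration R 3 1 0 q (fun y => 2 * Num.sqrt y) (fun y =>
    (Num.sqrt y)^-1) u 1 hq u0 u1 (lexx 1) (lexx 0)
    (fun s su => sqrt_calibration R _ (pos s su)).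
  apply: ae_eq_integral => //; [exact/measurable_EFinP|exact/measurable_EFinP|].
  have gae : ae_eq (@lebesgue_measure R) `[u, 1]%classic (fun s => (g s)%:E) (cst 0%E).
    apply/ae_eq_integral_abs => //; first exact/measurable_EFinP.
    by rewrite -[RHS]intg0; apply: eq_integral => s _; rewrite gee0_abs// lee_fin.
  apply: (@filterS2 _ _ (ae_filter_ringOfSetsType (@lebesgue_measure R)) _ _ _ _ good
    gae).
  move=> s hs gs su; have [_ v1 v2] := hs su; congr EFin.
  have := gs su; rewrite /g => -[] /max_idPl; rewrite subr_le0 => hDs.
  rewrite !max_r// mul1r !mul0r addr0 add0r -root4_sqr.
  apply: axis_gamma_eq => //; first exact: kpos.
  by move: hDs; rewrite /h !max_r// !mul1r addr0.
have [_ i1] := path_calibration R 3 1 1 q (fun y => 0 * y) (fun=>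
  0) u 1 hq u0 u1 (lexx 1) ler01
  (fun s _ => linear_calibration R 0 _ (lexx 0)).
have [_ i2] := path_calibration R 3 1 0 q (fun y => 2 * Num.sqrt y) (fun y =>
  (Num.sqrt y)^-1) u 1 hq u0 u1 (lexx 1) (lexx 0)
  (fun s su => sqrt_calibration R _ (pos s su)).
(* With x and y the coordinates at u, this reads 3 - x = 2 - 2 sqrt y. *)
move: hv; rewrite i1 i2 e1 /= sqrtr1 => -[]; lra.
Qed.

Lemma axis_time_le (R : realType) (q : R -> plane R) : lpp_path 3 1 q ->
  (path_time (axis_speed R) q <= (13/3 : R)%:E)%E.
Proof.
move=> hq; apply: le_trans (axis_reward_on_le R 3 1 0 1 q hq (lexx 0) ler01 (lexx 1)) _.
rewrite lee_fin (path_start hq) (path_end hq)/= /axis_potential !addr0 /root4.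
by rewrite !sqrtr0 !sqrtr1 expr0n expr1n/=; lra.
Qed.

(** b is the last time at height 0: by monotonicity the path is on the axis until then, and
    afterwards the parabola law applies. *)
Lemma axis_optimal_trace (R : realType) (q : R -> plane R) :
  lpp_path 3 1 q -> ((13/3 : R)%:E <= path_time (axis_speed R) q)%E ->
  exists b, [/\ b \in `[0, 1],
    forall s, s \in `[0, 1] -> s <= b -> (q s).1 <= 1 /\ (q s).2 = 0 &
    forall s, s \in `[0, 1] -> b < s ->
      0 < (q s).2 /\ (q s).1 = 1 + 2 * Num.sqrt (q s).2].
Proof.
move=> hq tq; have e0 := path_start hq; have e1 := path_end hq.
have cq1 := lpp_path_fst_cont R 3 1 q hq; have cq2 := lpp_path_snd_cont R 3 1 q hq.
have [||b [b01 qb hb]] := last_zero R (fun s => (q s).2) cq2.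
- by rewrite e1.
- by exists 0; rewrite ?e0// in_itv/= lexx ler01.
have late_eq s : s \in `[0, 1] -> b < s ->
  0 < (q s).2 /\ (q s).1 = 1 + 2 * Num.sqrt (q s).2.
  rewrite in_itv/= => /andP[s0 s1] bs; have qs := hb s bs s1.
  by split => //; exact: axis_optimal_parabola.
have /andP[b0 b1] : 0 <= b <= 1 by move: b01; rewrite in_itv.
have b_lt1 : b < 1.
  by rewrite lt_neqAle b1 andbT; apply/eqP => b1'; move: qb; rewrite b1' e1 /=; lra.
have qb1 : (q b).1 = 1.
  (* This vanishes after b, hence at b by continuity: the path leaves the axis at (1, 0). *)
  pose f s := (q s).1 - 1 - 2 * Num.sqrt (q s).2.
  have cf : {within `[0, 1], continuous f}.
    apply/subspace_continuousP => s s01; apply: cvgB.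
      by apply: cvgB; [exact: ((subspace_continuousP _ _).1 cq1)|exact: cvg_cst].
    apply: cvgM; first exact: cvg_cst.
    apply: (@cvg_comp _ _ _ (fun s =>
      (q s).2 : R) (@Num.sqrt R) _ (nbhs ((q s).2 : R))); last exact: sqrt_continuous.
    exact: ((subspace_continuousP _ _).1 cq2).
  suff : f b = 0 by rewrite /f qb sqrtr0; lra.
  apply/eqP/negP => /negP fb.
  have nf : \forall y \near f b, y != 0 by exact: (cvgr_neq0 (f b) cvg_id fb).
  have [e eps he] := within_itv_near R f (fun y => y != 0) b cf b01 nf.
  pose d := Num.min (e / 2) (1 - b).
  have d0 : 0 < d by rewrite lt_min divr_gt0//; lra.
  have de : d <= e / 2 by rewrite ge_min lexx.
  have db : d <= 1 - b by rewrite ge_min lexx orbT.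
  have bd01 : b + d \in `[0, 1] by rewrite in_itv/=; lra.
  have /eqP : f (b + d) != 0.
    by apply: he => //; rewrite addrAC subrr add0r gtr0_norm//; lra.
  by apply; have [] := late_eq (b + d) bd01 ltac:(lra); rewrite /f => _ ->; ring.
exists b; split => // s; rewrite in_itv/= => /andP[s0 s1] sb.
have [m1 m2] := lpp_path_mono R 3 1 q hq s b s0 sb b1.
have s01 : s \in `[0, 1] by rewrite in_itv/= s0.
have [_ q2] := path_quadrant hq s01.
by split; [rewrite -qb1|lra].
Qed.

Lemma axis_path_unique (R : realType) (q : R -> plane R) :
  lpp_path 3 1 q -> ((13/3 : R)%:E <= path_time (axis_speed R) q)%E ->
  same_curve (axis_path R) q.
Proof.
move=> hq tq; have e0 := path_start hq; have e1 := path_end hq.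
have [b [b01 early late]] := axis_optimal_trace R q hq tq.
(* The inverse of the strictly increasing abscissa of [axis_path] on [0, 1], namely 2 s and then 1 +
   2 (2 s - 1)^2. Thus [axis_path] at time G of the abscissa of q is at the position of q. *)
pose G (x : R) : R := Num.min x 1 / 2 + Num.sqrt (Num.max (x - 1) 0 / 2) / 2.
have cG : continuous G.
  move=> x; apply: cvgD; apply: cvgM; try exact: cvg_cst.
    by apply: (@continuous_min R R id (cst 1)); [exact: cvg_id|exact: cvg_cst].
  apply: (@cvg_comp _ _ _ (fun x =>
    Num.max (x - 1) 0 / 2) (@Num.sqrt R) _ (nbhs (Num.max (x - 1) 0 / 2)));
      last exact: sqrt_continuous.
  apply: cvgM; last exact: cvg_cst.
  apply: (@continuous_max R R (fun x => x - 1) (cst 0)); last exact: cvg_cst.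
  by apply: cvgB; [exact: cvg_id|exact: cvg_cst].
have homoG : {homo G : x y / x <= y}.
  move=> x y xy; rewrite /G lerD// ler_pM2r ?invr_gt0//.
    by rewrite le_min ge_min xy ge_min lexx orbT.
  rewrite ler_wsqrtr// ler_pM2r ?invr_gt0// ge_max !le_max lexx orbT andbT.
  by apply/orP; left; lra.
have G_le1 x : x <= 1 -> G x = x / 2.
  move=> x1; rewrite /G (min_idPl _)// (max_idPr _); last lra.
  by rewrite mul0r sqrtr0 mul0r addr0.
have G_gt1 r : 0 <= r -> G (1 + 2 * r) = (1 + Num.sqrt r) / 2.
  move=> r0; rewrite /G (min_idPr _); last lra.
  rewrite (max_idPl _); last lra.
  have -> : (1 + 2 * r - 1) / 2 = r by field.
  by rewrite mulrDl.
exists (fun s => G (q s).1), id; split; [split => //|split => //|].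
- apply/subspace_continuousP => s s01.
  apply: (@cvg_comp _ _ _ (fun s => (q s).1 : R) G _ (nbhs ((q s).1 : R)));
    last exact: cG.
  exact: ((subspace_continuousP _ _).1 (lpp_path_fst_cont R 3 1 q hq)).
- by rewrite e0 G_le1//= mul0r.
- rewrite e1 /=; have -> : 3 = 1 + 2 * 1 :> R by ring.
  by rewrite G_gt1// sqrtr1; field.
- move=> s t; rewrite !in_itv/= => /andP[s0 _] /andP[_ t1] st; apply: homoG.
  by have [] := lpp_path_mono R 3 1 q hq s t s0 st t1.
- by apply: continuous_subspaceT => x; exact: cvg_id.
move=> s s01; have [sb|bs] := leP s b.
  have [q1 q2] := early s s01 sb; rewrite G_le1// /axis_path late_early; last lra.
  rewrite (min_idPl _); last lra.
  rewrite [RHS]surjective_pairing q2; congr pair; first by field.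
  by rewrite expr0n.
have [q2 q1] := late s s01 bs; have r0 : 0 <= Num.sqrt (q s).2 := sqrtr_ge0 _.
have r4 : 0 <= Num.sqrt (Num.sqrt (q s).2) := sqrtr_ge0 _.
rewrite [RHS]surjective_pairing q1 G_gt1// /axis_path late_late; last lra.
rewrite (min_idPr _); last lra.
have -> : 2 * ((1 + Num.sqrt (Num.sqrt (q s).2)) / 2) - 1 = root4 R (q s).2.
  by rewrite /root4; field.
by rewrite root4_sqr root4_exp4 ?(ltW q2)//; congr pair; field.
Qed.

Lemma axis_path_maximiser (R : realType) :
  [/\ maximiser (axis_speed R) 3 1 (axis_path R),
      forall q, maximiser (axis_speed R) 3 1 q -> same_curve (axis_path R) q
    & initial_axis_segment (axis_path R)].
Proof.
have ap := axis_pathP R; have ta := axis_path_time R.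
split.
- by split => // q /axis_time_le hq; exact: le_trans ta.
- move=> q [hq qmax]; apply: axis_path_unique => //.
  by apply: le_trans ta _; exact: qmax.
- exists (1/2); split; first by rewrite in_itv/=; lra.
    rewrite /axis_path late_early// (min_idPl _)// => -[]; lra.
  left=> t; rewrite in_itv/= => /andP[_ t2].
  by rewrite /axis_path/= late_early// expr0n.
Qed.

Theorem theorem2p13 (R : realType) :
  (exists lambda r : R, let c := shifted_two_phase lambda r in
     [/\ 0 <= lambda, 0 < r < 1, speed_function c,
         ~ concave_on (quadrant (R := R)) (Gamma c)
       & exists t : R, ~ convex_curve (level_curve c t)]) /\
  (exists lambda r : R, let c := shifted_two_phase lambda r in
     [/\ 0 <= lambda, 0 < r < 1, speed_function c
       & exists t : R, contains_segment (level_curve c t)]) /\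
  (exists lambda r : R, let c := shifted_two_phase lambda r in
     [/\ 0 <= lambda, 0 < r < 1, speed_function c
       & exists u : plane R,
           [/\ 0 < u.1, 0 < u.2
             & ~ differentiable (Gamma c : plane R -> R^o) u]]) /\
  (exists c : plane R -> R, speed_function c /\
     exists x y : R, [/\ 0 <= x, 0 <= y
       & exists p q : R -> plane R,
           [/\ maximiser c x y p, maximiser c x y q & ~ same_curve p q]]) /\
  (exists c : plane R -> R, speed_function c /\
     exists x y : R, [/\ 0 < x, 0 < y
       & exists p : R -> plane R,
           [/\ maximiser c x y p,
               (forall q, maximiser c x y q -> same_curve p q)
             & initial_axis_segment p]]).
Proof.
have r12 : 0 < (1/12 : R) < 1 by lra.
have r34 : 0 < (3/4 : R) < 1 by lra.
split; [|split; [|split; [|split]]].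
- exists 1, (1/12); split => //.
  + exact: shifted_speed_function.
  + exact: Gamma_not_concave.
  + by exists 4; exact: level_curve_not_convex.
- exists 0, (3/4); split => //; first exact: shifted_speed_function.
  by exists (16/3); exact: level_curve_segment.
- exists 0, (3/4); split => //; first exact: shifted_speed_function.
  by exists (1, 1); split => //; exact: Gamma_not_differentiable.
- exists (shifted_two_phase 2 (3/4)); split; first exact: shifted_speed_function.
  by exists 4, 4; split => //; exact: two_maximisers.
- exists (axis_speed R); split; first exact: axis_speed_function.
  by exists 3, 1; split => //; exists (axis_path R); exact: axis_path_maximiser.
Qed.
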